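(* Let $\Gamma$ be a connected, locally finite graph of finite treewidth. Let a group $G$ act on $\Gamma$ such that the quotient graph $G\backslash\Gamma$ is finite and the stabilizer $G_v$ of each vertex $v\in V(\Gamma)$ is finite. Then $G$ acts (via the action $g\cdot C=gC$, $g\cdot[C]=[gC]$ induced from $\Gamma$) on the tree $T(\mathcal{C}_{\mathrm{opt}})$ such that all vertex and edge stabilizers are finite and $G\backslash T(\mathcal{C}_{\mathrm{opt}})$ is finite.
   Context: Graphs are undirected, simple (no loops, no multi-edges) and nonempty unless said otherwise. A tree is a connected simple graph without cycles (here the empty graph is not excluded as a value of $T(\mathcal{C}_{\mathrm{opt}})$ below). A tree decomposition of $\Gamma$ is a tree $T$ with a map $t\mapsto X_t$ from $V(T)$ to finite subsets of $V(\Gamma)$ (bags) such that: every vertex of $\Gamma$ lies in some $X_t$; both endpoints of every edge of $\Gamma$ lie in a common $X_t$; and if $v\in X_s\cap X_t$ then $v\in X_r$ for all $r$ on the geodesic from $s$ to $t$ in $T$. $\Gamma$ has finite treewidth if it has a tree decomposition with $\sup_t|X_t|<\infty$. Definition of $\mathcal{C}_{\mathrm{opt}}$. Let $\Gamma$ be connected and locally finite. For $C\subseteq V(\Gamma)$ let $\overline{C}=V(\Gamma)\setminus C$ and let $\delta C$ be the set of edges with one endpoint in $C$ and the other in $\overline{C}$. A cut is a set $C\subseteq V(\Gamma)$ such that $C$ and $\overline{C}$ are nonempty and (induce) connected (subgraphs) and $\delta C$ is finite; it is a $k$-cut if $|\delta C|\le k$. A bi-infinite simple path $\alpha$ is a sequence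 $(v_i)_{i\in\mathbb{Z}}$ of pairwise distinct vertices with $v_{i-1}v_i$ an edge for all $i$. Put $\mathcal{C}(\alpha)=\{C : C \text{ is a cut and } |\alpha\cap C|=\infty=|\alpha\cap\overline{C}|\}$. $\Gamma$ is accessible if there is $k\in\mathbb{N}$ such that for every bi-infinite simple path $\alpha$ either $\mathcal{C}(\alpha)=\emptyset$ or $\mathcal{C}(\alpha)$ contains a $k$-cut. (Graphs satisfying the hypotheses of the claim are accessible, so the following applies.) Fix such a $k$ for the accessible graph $\Gamma$. Let $\mathcal{C}_{\min}(\alpha)$ be the set of $C\in\mathcal{C}(\alpha)$ with $|\delta C|$ minimal in $\mathcal{C}(\alpha)$. Cuts $C,D$ are nested if one of $C\subseteq D$, $C\subseteq\overline{D}$, $\overline{C}\subseteq D$, $\overline{C}\subseteq\overline{D}$ holds. For a cut $C$ let $m(C)$ be the number of $k$-cuts that are not nested with $C$ (this is finite). Let $m_\alpha=\min\{m(C): C\in\mathcal{C}_{\min}(\alpha)\}$, $\mathcal{C}_{\mathrm{opt}}(\alpha)=\{C\in\mathcal{C}_{\min}(\alpha): m(C)=m_\alpha\}$, and $\mathcal{C}_{\mathrm{opt}}=\bigcup_\alpha\mathcal{C}_{\mathrm{opt}}(\alpha)$ over all bi-infinite simple paths $\alpha$. Structure tree. For $C,D\in\mathcal{C}_{\mathrm{opt}}$ write $C\sim D$ if either $C=D$, or both $\overline{C}\subsetneq D$ and for all $E\in\mathcal{C}_{\mathrm{opt}}$: $\overline{C}\subsetneq E\subseteq D$ implies $E=D$.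 This is an equivalence relation; $[C]$ denotes the class of $C$. $T(\mathcal{C}_{\mathrm{opt}})$ is the graph with vertex set $\{[C]: C\in\mathcal{C}_{\mathrm{opt}}\}$ and (directed) edge set $\mathcal{C}_{\mathrm{opt}}$, where the edge $C$ has source $[C]$, target $[\overline{C}]$ and inverse edge $\overline{C}$; it is a tree. *)

(* Defs.v *)
From HB Require Import structures.
From mathcomp Require Import all_boot all_order all_algebra finmap.
From mathcomp Require Import boolp classical_sets functions cardinality.

Set Implicit Arguments.
Unset Strict Implicit.
Unset Printing Implicit Defensive.

Local Open Scope classical_set_scope.
Local Open Scope card_scope.

(* Undirected simple graphs, possibly infinite or empty. *)
Record sgraph := SGraph {
  vertex :> choiceType;
  adj : rel vertex;
  adj_sym : symmetric adj;
  adj_irr : irreflexive adj }.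

Section SimpleGraphs.
Variable Gam : sgraph.
Implicit Types (u v w : Gam) (C D : set Gam).

(* The subgraph induced by C is connected (C may be empty). *)
Definition connected_in C :=
  forall u v, C u -> C v ->
    exists p : seq Gam,
      [/\ path (@adj Gam) u p, last u p = v & forall w, w \in p -> C w].

Definition connected_graph := connected_in setT.

Definition acyclic :=
  forall c : seq Gam, 3 <= size c -> uniq c -> ~~ cycle (@adj Gam) c.

Definition is_tree := connected_graph /\ acyclic.

Definition locally_finite := forall v, finite_set [set u | adj v u].

(* An undirected edge is represented by the set of its two endpoints. *)
Definition edges : set (set Gam) :=
  [set e | exists u v, adj u v /\ e = [set u; v]].

(* u :: p is the vertex sequence of a geodesic from u to v. *)
Definition geodesic u v (p : seq Gam) :=
  [/\ path (@adj Gam) u p, last u p = v &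
      forall q, path (@adj Gam) u q -> last u q = v -> size p <= size q].

End SimpleGraphs.

Arguments connected_graph : clear implicits.
Arguments acyclic : clear implicits.
Arguments is_tree : clear implicits.
Arguments locally_finite : clear implicits.
Arguments edges : clear implicits.

Definition tree_decomposition (Gam T : sgraph) (X : T -> {fset Gam}) :=
  [/\ is_tree T,
      forall v : Gam, exists t, v \in X t,
      forall u v : Gam, adj u v -> exists t, (u \in X t) && (v \in X t) &
      forall (v : Gam) (s t r : T) (p : seq T),
        v \in X s -> v \in X t -> geodesic s t p -> r \in s :: p ->
        v \in X r].

Definition finite_treewidth (Gam : sgraph) :=
  exists (T : sgraph) (X : T -> {fset Gam}),
    tree_decomposition X /\ exists n : nat, forall t, #|` X t| <= n.

Section Cuts.
Variable Gam : sgraph.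
Implicit Types (C D E : set Gam) (alpha : int -> Gam).

Definition boundary C : set (set Gam) :=
  [set e | edges Gam e /\ exists u v, [/\ C u, (~` C) v & e = [set u; v]]].

Definition cut C :=
  [/\ C !=set0, ~` C !=set0, connected_in C, connected_in (~` C) &
      finite_set (boundary C)].

Definition kcut (k : nat) C := cut C /\ boundary C #<= `I_k.

Definition biinfinite_path alpha :=
  injective alpha /\ forall i : int, adj (alpha (i - 1)%R) (alpha i).

Definition cuts alpha : set (set Gam) :=
  [set C | [/\ cut C, infinite_set (range alpha `&` C) &
               infinite_set (range alpha `&` ~` C)]].

Definition accessible_with (k : nat) :=
  forall alpha, biinfinite_path alpha ->
    cuts alpha = set0 \/ exists2 C, cuts alpha C & kcut k C.

Definition accessible := exists k, accessible_with k.

Definition cuts_min alpha : set (set Gam) :=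
  [set C | cuts alpha C /\
           forall D, cuts alpha D -> boundary C #<= boundary D].

Definition nested C D :=
  [\/ C `<=` D, C `<=` ~` D, ~` C `<=` D | ~` C `<=` ~` D].

(* The k-cuts counted by m(C). *)
Definition crossing (k : nat) C : set (set Gam) :=
  [set D | kcut k D /\ ~ nested C D].

(* The condition m(C) = m_alpha, i.e. m(C) <= m(D) for all D in
   C_min(alpha), is expressed by comparing the cardinals of the sets that
   m counts; this needs no default value in case such a set is infinite. *)
Definition cuts_opt_for (k : nat) alpha : set (set Gam) :=
  [set C | cuts_min alpha C /\
           forall D, cuts_min alpha D -> crossing k C #<= crossing k D].

Definition cuts_opt (k : nat) : set (set Gam) :=
  \bigcup_(alpha in [set a | biinfinite_path a]) cuts_opt_for k alpha.

Definition cut_sim (k : nat) C D :=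
  C = D \/
  ~` C `<` D /\
  forall E, cuts_opt k E -> ~` C `<` E -> E `<=` D -> E = D.

Definition cut_class (k : nat) C : set (set Gam) :=
  [set D | cuts_opt k D /\ cut_sim k C D].

Lemma boundaryC C : boundary (~` C) = boundary C.
Proof.
have sub D : boundary D `<=` boundary (~` D).
  move=> e [he [u [v [Du Dv eE]]]]; split=> //; exists v, u; rewrite setCK.
  by split=> //; rewrite eE setUC.
by apply/seteqP; split=> [e /sub|]; [rewrite setCK | exact: sub].
Qed.

Lemma cutC C : cut C -> cut (~` C).
Proof. by case=> ? ? ? ? ?; split; rewrite ?setCK ?boundaryC. Qed.

Lemma cutsC alpha C : cuts alpha C -> cuts alpha (~` C).
Proof. by case=> /cutC ? ? ?; split; rewrite ?setCK. Qed.

Lemma cuts_minC alpha C : cuts_min alpha C -> cuts_min alpha (~` C).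
Proof. by case=> /cutsC hC hm; split=> // D /hm; rewrite boundaryC. Qed.

Lemma crossingC k C : crossing k (~` C) = crossing k C.
Proof.
apply/seteqP; split=> D [hD hn]; split=> // hN; apply: hn; case: hN;
  rewrite ?setCK => h;
  by [apply: Or41; rewrite ?setCK | apply: Or42; rewrite ?setCK
     |apply: Or43; rewrite ?setCK | apply: Or44; rewrite ?setCK].
Qed.

Lemma cuts_optC k C : cuts_opt k C -> cuts_opt k (~` C).
Proof.
case=> alpha ha [/cuts_minC hC hm]; exists alpha => //; split=> // D /hm.
by rewrite crossingC.
Qed.

Lemma cuts_opt_neqC k C : cuts_opt k C -> ~` C <> C.
Proof.
case=> alpha _ [[[[[x Cx] _ _ _ _] _ _] _] _] e.
by have : (~` C) x by rewrite e.
Qed.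

End Cuts.

Arguments cuts_opt : clear implicits.

(* Graphs given by directed edges with an inversion. *)
Record dgraph := DGraph {
  dvertex : choiceType;
  dedge : choiceType;
  source : dedge -> dvertex;
  target : dedge -> dvertex;
  inv : dedge -> dedge;
  invK : involutive inv;
  inv_neq : forall e, inv e <> e;
  source_inv : forall e, source (inv e) = target e }.

Section Underlying.
Variable T : dgraph.

Definition dadj : rel (dvertex T) :=
  fun x y => (x != y) && `[< exists e, source e = x /\ target e = y >].

Lemma dadj_sym : symmetric dadj.
Proof.
suff h x y : dadj x y -> dadj y x by move=> x y; apply/idP/idP; apply: h.
case/andP=> xy /asboolP [e [ex ey]]; rewrite /dadj eq_sym xy /=.
apply/asboolP; exists (inv e).
by rewrite source_inv -[target (inv e)]source_inv invK.
Qed.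

Lemma dadj_irr : irreflexive dadj.
Proof. by move=> x; rewrite /dadj eqxx. Qed.

Definition underlying : sgraph := SGraph dadj_sym dadj_irr.

(* T is simple (no loops, no multiple edges) and is a tree. *)
Definition dgraph_tree :=
  [/\ forall e : dedge T, source e <> target e,
      forall e f : dedge T, source e = source f -> target e = target f -> e = f
    & is_tree underlying].

End Underlying.

Section StructureTree.
Variables (Gam : sgraph) (k : nat).

Definition st_edge : choiceType := cuts_opt Gam k.

Definition st_vertex : choiceType :=
  [set cut_class k C | C in cuts_opt Gam k].

Definition st_cut (C : st_edge) : set Gam := val C.

Definition st_class (C : st_edge) : st_vertex :=
  SigSub (mem_set (imageP (cut_class k) (set_valP C))).

Definition st_inv (C : st_edge) : st_edge :=
  SigSub (mem_set (cuts_optC (set_valP C))).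

Lemma st_invK : involutive st_inv.
Proof. by move=> C; apply: val_inj; rewrite /= setCK. Qed.

Lemma st_inv_neq C : st_inv C <> C.
Proof. by move=> /(congr1 val); apply: cuts_opt_neqC (set_valP C). Qed.

Definition structure_tree : dgraph :=
  @DGraph st_vertex st_edge st_class (fun C => st_class (st_inv C)) st_inv
    st_invK st_inv_neq (fun=> erefl).

End StructureTree.

Section Actions.
Variable G : groupType.

Definition is_action (S : Type) (a : G -> S -> S) :=
  (forall x, a 1%g x = x) /\ (forall g h x, a (g * h)%g x = a g (a h x)).

Definition stabilizer (S : Type) (a : G -> S -> S) (x : S) : set G :=
  [set g | a g x = x].

Definition orbit (S : Type) (a : G -> S -> S) (x : S) : set S :=
  range (fun g => a g x).

Definition orbits (S : Type) (a : G -> S -> S) (A : set S) : set (set S) :=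
  [set orbit a x | x in A].

Definition set_action (S : Type) (a : G -> S -> S) (g : G) (A : set S) :
  set S := a g @` A.

Definition graph_action (Gam : sgraph) (a : G -> Gam -> Gam) :=
  is_action a /\ forall g u v, adj (a g u) (a g v) = adj u v.

Definition finite_quotient (Gam : sgraph) (a : G -> Gam -> Gam) :=
  finite_set (orbits a setT) /\
  finite_set (orbits (set_action a) (edges Gam)).

Definition dgraph_action (T : dgraph)
    (av : G -> dvertex T -> dvertex T) (ae : G -> dedge T -> dedge T) :=
  [/\ is_action av, is_action ae,
      forall g e, source (ae g e) = av g (source e),
      forall g e, target (ae g e) = av g (target e) &
      forall g e, inv (ae g e) = ae g (inv e)].

Definition finite_dquotient (T : dgraph)
    (av : G -> dvertex T -> dvertex T) (ae : G -> dedge T -> dedge T) :=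
  finite_set (orbits av setT) /\ finite_set (orbits ae setT).

End Actions.

(* Main.v *)
Require Import Defs.
From mathcomp Require Import all_boot all_order all_algebra finmap.
From mathcomp Require Import boolp classical_sets functions cardinality.
From mathcomp Require Import zify.

(** The crossing number of a cut is the number of k-cuts it is not nested with.
    The theorem rests on four facts.

    Bounded cuts.  Only finitely many k-cuts separate two given vertices
    ([finite_kcuts_separating]).  Hence crossing numbers and intervals of
    optimal cuts are finite.  If bags have at most m elements and degrees are at
    most d, a component left by a bag is bounded by at most m * d edges.  Given a
    cut splitting a path alpha, take a finite subtree of the decomposition tree
    whose bags cover the ends of the cut; a component outside these bags attaches
    to a single bag, and one such component splits alpha at cost m * d.  This is
    accessibility ([accessible_treewidth]).

    Nestedness.  If optimal cuts C for alpha and D for beta crossed, one of two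
    opposite corners would split alpha and the other beta, unless D is optimal for
    alpha too and each of them splits alpha.  Boundary sizes and crossing numbers
    are submodular on corners, the latter strictly, because C crosses D but neither
    corner of the pair; this contradicts optimality
    ([no_opposite_corners], [opt_nested]).

    Trees from nested cuts.  Covering pairs define the vertices.  Finite intervals
    give paths between any two classes, and going around a cycle would give a
    strictly increasing cyclic chain of cuts ([st_tree]).

    Finiteness of the action.  Every optimal cut has a translate splitting one
    fixed finite set, so there are finitely many orbits ([opt_representatives]),
    and an element fixing a cut permutes the finitely many ends of its boundary,
    so edge stabilizers are finite.  Let H be the stabilizer of a class [C].  It
    acts with finitely many orbits on a connected block of vertices that has only
    finitely many vertices behind each cut of the class.  If H were infinite, so
    would be the block.  A median bag balances large finite parts of the block, so
    there are cuts of bounded size with arbitrarily many block vertices on both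
    sides ([balanced_cut]).  Up to H these are finitely many cuts, so a single one
    leaves infinitely many block vertices on either side, and it splits a
    bi-infinite path whose vertices, up to finitely many, lie in the block.  An
    optimal cut for that path has a side hidden behind some cut of the class,
    where the path has only finitely many vertices: a contradiction
    ([finite_class_stabilizer]). *)

Set Implicit Arguments.
Unset Strict Implicit.
Unset Printing Implicit Defensive.

Local Open Scope classical_set_scope.

(** * Paths, components and boundaries *)

Section Reach.
Variables (V : choiceType) (e : rel V).
Implicit Types (A B C : set V) (u v w x y : V).

Definition reach A u v :=
  exists p, [/\ path e u p, last u p = v & forall w, w \in u :: p -> A w].

Lemma reach_refl A u : A u -> reach A u u.
Proof. by move=> Au; exists [::]; split=> // w; rewrite inE => /eqP->. Qed.

Lemma reach_step A u v : A u -> A v -> e u v -> reach A u v.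
Proof.
move=> Au Av uv; exists [:: v]; split=> //=; first by rewrite uv.
by move=> w; rewrite !inE => /orP[] /eqP->.
Qed.

Lemma reach_trans A v u w : reach A u v -> reach A v w -> reach A u w.
Proof.
case=> p [pp pl pA] [q [qp ql qA]]; exists (p ++ q); split.
- by rewrite cat_path pp pl.
- by rewrite last_cat pl.
- move=> x; rewrite inE mem_cat orbA => /orP[xp|xq]; first by apply: pA.
  by apply: qA; rewrite inE xq orbT.
Qed.

(** The invariance principle through which most path arguments are run: a
   property carried along the edges inside A is inherited by whatever is reached. *)
Lemma reach_ind A (Q : V -> Prop) u v :
  Q u -> (forall x y, A x -> A y -> e x y -> Q x -> Q y) ->
  reach A u v -> Q v.
Proof.
move=> Qu step [p [pp <- pA]]; elim: p u Qu pp pA => //= y p IH u Qu.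
case/andP=> uy py pA; apply: (IH y) => //.
- by apply: (step u y) => //; apply: pA; rewrite !inE eqxx ?orbT.
- by move=> w wp; apply: pA; rewrite inE wp orbT.
Qed.

Lemma reach_inl A u v : reach A u v -> A u.
Proof. by case=> p [_ _]; apply; rewrite mem_head. Qed.

Lemma reach_inr A u v : reach A u v -> A v.
Proof. by case=> p [_ <-]; apply; rewrite mem_last. Qed.

Lemma reach_sub A B u v : A `<=` B -> reach A u v -> reach B u v.
Proof. by move=> AB [p [pp pl pA]]; exists p; split=> // w /pA /AB. Qed.

Lemma reach_sym A u v : symmetric e -> reach A u v -> reach A v u.
Proof.
move=> es uv; have Au := reach_inl uv; move: uv.
apply: (@reach_ind A (fun v => reach A v u)); first exact: reach_refl.
by move=> x y Ax Ay xy; apply: reach_trans; apply: reach_step; rewrite // es.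
Qed.

(** The first edge leaving C along the path; were there none, everything reached
   would stay in C. *)
Lemma reach_exit A C u v : reach A u v -> C u -> ~ C v ->
  exists x y, [/\ reach (A `&` C) u x, A y, ~ C y & e x y].
Proof.
move=> uv Cu nCv; apply: contrapT => h; have Au := reach_inl uv.
suff : reach (A `&` C) u v by move=> /reach_inr[].
move: uv; apply: (@reach_ind A (reach (A `&` C) u)); first exact: reach_refl.
move=> x y Ax Ay xy ux; have [_ Cx] := reach_inr ux.
have [Cy|nCy] := pselect (C y); last by case: h; exists x, y.
by apply: reach_trans ux _; apply: reach_step.
Qed.

Lemma reach_path_prefix u p x : path e u p -> x \in u :: p ->
  reach [set` u :: p] u x.
Proof.
move=> pp xp; case/splitPl: xp pp => p1 p2 l1.
rewrite cat_path => /andP[pp1 _]; exists p1; split=> // w.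
by rewrite /= !inE mem_cat orbA => ->.
Qed.

Lemma reach_shorten A u v : reach A u v ->
  exists p, [/\ path e u p, last u p = v, uniq (u :: p) &
                forall w, w \in u :: p -> A w].
Proof.
case=> p [pp pl pA]; case/shortenP: pp pl => q qp qu qs ql.
exists q; split=> // w; rewrite inE => /orP[/eqP->|/qs wp].
  by apply: pA; rewrite mem_head.
by apply: pA; rewrite inE wp orbT.
Qed.

End Reach.

Section Connectivity.
Variable Gam : sgraph.
Implicit Types (A B C : set Gam) (u v w x y : Gam).

Local Notation reach := (reach (@adj Gam)).

Lemma reachC A u v : reach A u v -> reach A v u.
Proof. exact/reach_sym/adj_sym. Qed.

Lemma connected_inP A :
  connected_in A <-> forall u v, A u -> A v -> reach A u v.
Proof.
split=> h u v Au Av; case: (h u v Au Av) => p.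
  by case=> pp pl pA; exists p; split=> // w; rewrite inE => /orP[/eqP->|/pA].
case=> pp pl pA; exists p; split=> // w wp.
by apply: pA; rewrite inE wp orbT.
Qed.

Lemma connected_from A b : (forall x, A x -> reach A b x) -> connected_in A.
Proof.
move=> h; apply/connected_inP => u v Au Av.
by apply: reach_trans (h v Av); apply/reachC/h.
Qed.

Lemma connected_component A v : connected_in (reach A v).
Proof.
apply: (@connected_from _ v) => x vx; have Av := reach_inl vx.
move: (vx).
apply: (@reach_ind _ _ A (reach (reach A v) v)) => [|y z Ay Az yz vy].
  by apply/reach_refl/reach_refl.
apply: reach_trans (vy) _; have vy' := reach_inr vy.
apply: reach_step => //; apply: reach_trans vy' _; exact: reach_step.
Qed.

Lemma connectedU A B : connected_in A -> connected_in B ->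
  A `&` B !=set0 -> connected_in (A `|` B).
Proof.
move=> /connected_inP cA /connected_inP cB [b [Ab Bb]].
apply: (@connected_from _ b) => x [Ax|Bx].
  by apply: (reach_sub (@subsetUl _ A B)); apply: cA.
by apply: (reach_sub (@subsetUr _ A B)); apply: cB.
Qed.

Hypothesis conn : connected_graph Gam.

Lemma reachT u v : reach setT u v.
Proof. exact: (connected_inP setT).1. Qed.

Lemma cross_edge C u v : C u -> ~ C v ->
  exists x y, [/\ C x, ~ C y & adj x y].
Proof.
move=> Cu nCv; have [x [y [ux _ nCy xy]]] := reach_exit (reachT u v) Cu nCv.
by exists x, y; split=> //; case: (reach_inr ux).
Qed.

(** Join each vertex of F to a base vertex by one path. *)
Lemma finite_connected_hull (F : set Gam) : finite_set F ->
  exists Z, [/\ finite_set Z, F `<=` Z & connected_in Z].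
Proof.
move=> finF; have [[b Fb]|] := pselect (F !=set0); last first.
  by move/nonemptyPn ->; exists set0; split=> // ? ? [].
have /choice[p pP] : forall f, exists p, path (@adj Gam) b p /\ last b p = f.
  by move=> f; have [p [pp pl _]] := reachT b f; exists p.
have sub f : F f -> [set` b :: p f] `<=` \bigcup_(f in F) [set` b :: p f].
  by move=> Ff x xf; exists f.
exists (\bigcup_(f in F) [set` b :: p f]); split.
- by apply: bigcup_finite => // f _; apply: finite_seq.
- by move=> f Ff; apply: (sub f Ff); rewrite /= -{1}(pP f).2 mem_last.
- apply: (@connected_from _ b) => x [f Ff xf]; apply: reach_sub (sub f Ff) _.
  by apply: reach_path_prefix => //; case: (pP f).
Qed.

End Connectivity.

Section Counting.
Variable T : choiceType.
Implicit Types A B X Y : set T.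

(** A natural number carrying the cardinal comparisons of finite sets; it is only
   meaningful for finite A, as [fset_set] sends an infinite set to the empty one. *)
Definition ncard A := #|` fset_set A|.

Lemma ncard_le (U : choiceType) A (B : set U) : finite_set B -> (A #<= B)%card ->
  ncard A <= #|` fset_set B|.
Proof.
move=> /finite_setP[n Bn] AB; rewrite (card_fset_set Bn).
by apply: geq_card_fset_set; rewrite -(card_le_eqr Bn).
Qed.

Lemma le_ncard (U : choiceType) A (B : set U) : finite_set A -> finite_set B ->
  ncard A <= #|` fset_set B| -> (A #<= B)%card.
Proof.
move=> /finite_setP[m Am] /finite_setP[n Bn].
rewrite /ncard (card_fset_set Am) (card_fset_set Bn).
by rewrite (card_le_eqr Bn) (card_le_eql Am) card_le_II.
Qed.

Lemma ncard_sub A B : finite_set B -> A `<=` B -> ncard A <= ncard B.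
Proof. by move=> fB AB; apply: ncard_le => //; apply: subset_card_le. Qed.

Lemma ncardUI A B : finite_set A -> finite_set B ->
  ncard (A `|` B) + ncard (A `&` B) = ncard A + ncard B.
Proof.
by move=> fA fB; rewrite /ncard fset_setU // fset_setI // cardfsUI.
Qed.

Lemma ncard_sub_eq A B : finite_set B -> A `<=` B -> ncard B <= ncard A ->
  A = B.
Proof.
move=> fB AB le; have fA := sub_finite_set AB fB.
apply: (fset_set_inj fA fB).
by apply/eqP; rewrite eqEfcard le andbT -fset_set_sub.
Qed.

(** The counting form of submodularity: the union and the intersection of two
   families are compared separately. *)
Lemma ncard_uncross A B X Y : finite_set X -> finite_set Y ->
  A `|` B `<=` X `|` Y -> A `&` B `<=` X `&` Y ->
  ncard A + ncard B <= ncard X + ncard Y.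
Proof.
move=> fX fY hU hI; have fU : finite_set (A `|` B).
  by apply: sub_finite_set hU _; rewrite finite_setU.
move: (fU); rewrite finite_setU => -[fA fB].
rewrite -(ncardUI fA fB) -(ncardUI fX fY); apply: leq_add; apply: ncard_sub => //.
  by rewrite finite_setU.
exact: finite_setIl.
Qed.

Lemma ncard_uncross_lt A B X Y z : finite_set X -> finite_set Y ->
  A `|` B `<=` X `|` Y -> A `&` B `<=` X `&` Y ->
  (X `|` Y) z -> ~ (A `|` B) z ->
  ncard A + ncard B < ncard X + ncard Y.
Proof.
move=> fX fY hU hI zX zA; have fXY : finite_set (X `|` Y) by rewrite finite_setU.
have fU := sub_finite_set hU fXY.
move: (fU); rewrite finite_setU => -[fA fB].
rewrite -(ncardUI fA fB) -(ncardUI fX fY) -addSn; apply: leq_add; last first.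
  by apply: ncard_sub => //; exact: finite_setIl.
rewrite ltnNge; apply/negP => le; apply: zA.
by rewrite (ncard_sub_eq fXY hU le).
Qed.

End Counting.

Section Boundary.
Variable Gam : sgraph.
Implicit Types (A B C : set Gam) (u v w x y : Gam).

Local Notation reach := (reach (@adj Gam)).

Lemma set2_inj (T : Type) (a b u v : T) : [set a; b] = [set u; v] ->
  a = u /\ b = v \/ a = v /\ b = u.
Proof.
move=> e; have : [set u; v] a by rewrite -e; left.
have : [set u; v] b by rewrite -e; right.
have : [set a; b] u by rewrite e; left.
have : [set a; b] v by rewrite e; right.
by move=> [] ? [] ? [] ? [] ?; subst; auto.
Qed.

Lemma boundaryP C e : boundary C e <->
  exists u v, [/\ adj u v, C u, ~ C v & e = [set u; v]].
Proof.
split=> [[[u' [v' [uv' ->]]] [u [v [Cu nCv euv]]]]|[u [v [uv Cu nCv ->]]]].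
  exists u, v; split=> //.
  by move: uv'; case: (set2_inj euv) => [[-> ->]|[-> ->]] //; rewrite adj_sym.
by split; exists u, v.
Qed.

Lemma boundary_mk C u v : adj u v -> C u -> ~ C v -> boundary C [set u; v].
Proof. by move=> uv Cu nCv; apply/boundaryP; exists u, v. Qed.

Lemma boundary_mk2 C u v : adj u v -> ~ C u -> C v -> boundary C [set u; v].
Proof. by move=> uv nCu Cv; rewrite setUC; apply: boundary_mk; rewrite 1?adj_sym. Qed.

Lemma boundary_pair C u v : boundary C [set u; v] ->
  C u /\ ~ C v \/ ~ C u /\ C v.
Proof.
move=> /boundaryP[x [y [_ Cx nCy e]]].
by case: (set2_inj e) => -[-> ->]; [left|right].
Qed.

Definition ends C : set Gam := \bigcup_(e in boundary C) e.

Lemma finite_ends C : finite_set (boundary C) -> finite_set (ends C).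
Proof.
move=> fC; apply: bigcup_finite => // e /boundaryP[u [v [_ _ _ ->]]].
exact: finite_set2.
Qed.

Lemma ends_mk C u v : adj u v -> C u -> ~ C v -> ends C u /\ ends C v.
Proof.
move=> uv Cu nCv; have b := boundary_mk uv Cu nCv.
by split; exists [set u; v] => //; [left|right].
Qed.

Lemma ends_mk2 C u v : adj u v -> ~ C u -> C v -> ends C u /\ ends C v.
Proof.
by move=> uv nCu Cv; rewrite adj_sym in uv; case: (ends_mk uv Cv nCu).
Qed.

Definition outer A : set Gam := [set y | ~ A y /\ exists2 x, A x & adj x y].

Lemma outer_sub_ends A : outer A `<=` ends A.
Proof. by move=> y [nAy [x Ax xy]]; case: (ends_mk xy Ax nAy). Qed.

Hypothesis conn : connected_graph Gam.

Lemma ends_nonempty C : C !=set0 -> ~` C !=set0 -> ends C !=set0.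
Proof.
move=> [u Cu] [v nCv]; have [x [y [Cx nCy xy]]] := cross_edge conn Cu nCv.
by exists x; case: (ends_mk xy Cx nCy).
Qed.

(** A vertex outside A is led by a path towards A to the component of a vertex
   attached to A; so the components of the complement are indexed by [outer A]. *)
Lemma outer_reach A x : A !=set0 -> ~ A x ->
  exists2 y, outer A y & reach (~` A) y x.
Proof.
move=> [a Aa] nAx.
have [y [z [xy _ Az yz]]] := @reach_exit _ _ _ (~` A) _ _ (reachT conn x a) nAx
  (fun h => h Aa).
have xy' : reach (~` A) x y by apply: reach_sub xy => ? [].
exists y; last exact: reachC.
split; first exact: reach_inr xy'.
by exists z; rewrite 1?adj_sym //; apply: contrapT.
Qed.

(** Only finitely many components lie outside A, at most one for each attached
   vertex. *)
Lemma component_pigeonhole A I : A !=set0 -> finite_set (outer A) ->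
  infinite_set I -> I `<=` ~` A ->
  exists v, ~ A v /\ infinite_set (I `&` reach (~` A) v).
Proof.
move=> A0 fA infI IA; apply: contrapT => h; apply: infI.
apply: (@sub_finite_set _ _ (\bigcup_(y in outer A) (I `&` reach (~` A) y))).
  move=> x Ix; have [y yA yx] := outer_reach A0 (IA x Ix).
  by exists y.
apply: bigcup_finite => // y yA; apply: contrapT => inf; apply: h.
by exists y; split => //; case: yA.
Qed.

Section Component.
Variables (A : set Gam) (v : Gam).
Hypotheses (cA : connected_in A) (A0 : A !=set0).

Lemma component_subC : A `<=` ~` reach (~` A) v.
Proof. by move=> x Ax /reach_inr. Qed.

Lemma component_step x y : reach (~` A) v x -> adj x y ->
  ~ A y -> reach (~` A) v y.
Proof.
move=> vx xy nAy; apply: reach_trans (vx) _; apply: reach_step => //.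
exact: reach_inr vx.
Qed.

Lemma outer_component : outer (reach (~` A) v) `<=` A.
Proof.
move=> y [nvy [x vx xy]]; apply: contrapT => nAy; apply: nvy.
exact: component_step vx xy nAy.
Qed.

(** The remaining components of the complement of A all hang on A. *)
Lemma connected_componentC : connected_in (~` reach (~` A) v).
Proof.
set K := reach (~` A) v; have [a Aa] := A0.
suff h x : (~` K) x -> exists2 b, A b & reach (~` K) x b.
  apply: (@connected_from _ _ a) => x /h[b Ab xb].
  apply: reach_trans (reachC xb); apply: reach_sub component_subC _.
  exact: (connected_inP A).1.
move=> nKx; have [Ax|nAx] := pselect (A x).
  by exists x => //; apply: reach_refl.
have [y yA yx] := outer_reach A0 nAx.
have nKy z : reach (~` A) y z -> ~ K z.
  move=> yz Kz; apply: nKx; apply: reach_trans Kz _.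
  exact: reach_trans (reachC yz) yx.
case: yA => nAy [b Ab bx]; exists b => //; apply: reachC.
apply: (@reach_trans _ _ _ y).
  apply: reach_step => //; first exact: component_subC.
  by apply: nKy; apply: reach_refl.
case: yx => p [pp pl pA]; exists p; split=> // w wp; apply: nKy.
apply: reach_sub (reach_path_prefix pp wp) => z; exact: pA.
Qed.

Lemma boundary_component : boundary (reach (~` A) v) `<=` boundary A.
Proof.
move=> e /boundaryP[x [y [xy vx nvy ->]]]; apply: boundary_mk2 => //.
  exact: reach_inr vx.
by apply: outer_component; split=> //; exists x.
Qed.

Lemma cut_component : ~ A v -> finite_set (boundary A) ->
  cut (reach (~` A) v).
Proof.
move=> nAv fA; split.
- by exists v; apply: reach_refl.
- by case: A0 => a Aa; exists a; apply: component_subC.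
- exact: connected_component.
- exact: connected_componentC.
- exact: sub_finite_set boundary_component fA.
Qed.

(** A second component of the complement of A would have boundary edges of its own. *)
Lemma component_whole : boundary A `<=` boundary (reach (~` A) v) ->
  ~` A = reach (~` A) v.
Proof.
move=> sub; apply/seteqP; split=> [x nAx|x /reach_inr//].
have [y [nAy [z Az zy]] yx] := outer_reach A0 nAx.
have /sub/boundary_pair[[/component_subC//]|[_ vy]] := boundary_mk zy Az nAy.
exact: reach_trans vy yx.
Qed.

End Component.

Hypothesis lf : locally_finite Gam.

Lemma finite_neighbours (F : set Gam) : finite_set F ->
  finite_set [set y | exists2 x, F x & adj x y].
Proof.
move=> fF; apply: (@sub_finite_set _ _ (\bigcup_(x in F) [set u | adj x u])).
  by move=> y [x Fx xy]; exists x.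
by apply: bigcup_finite => // x _; apply: lf.
Qed.

End Boundary.

(** * Finiteness of bounded cuts *)

Section FiniteCuts.
Variable Gam : sgraph.
Implicit Types (C D : set Gam) (u v w x y : Gam).

Local Notation greach := (reach (@adj Gam)).

Lemma kcutE k C : kcut k C <-> cut C /\ ncard (boundary C) <= k.
Proof.
split=> -[cC h]; split=> //; first exact: geq_card_fset_set.
case: cC => _ _ _ _ /finite_setP[n Cn].
by rewrite (card_le_eql Cn) card_le_II -(card_fset_set Cn).
Qed.

Lemma finite_boundary C : cut C -> finite_set (boundary C).
Proof. by case. Qed.

Section Separating.
Variables (u v : Gam).

Let avoid (F : {fset set Gam}) : rel Gam :=
  fun x y => adj x y && ([set x; y] \notin F).

Let sepcuts (F : {fset set Gam}) k : set (set Gam) :=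
  [set C | [/\ cut C, C u, ~ C v, [set` F] `<=` boundary C &
               ncard (boundary C) <= k]].

(** Edges inside C are not boundary edges, so C stays connected once F is deleted. *)
Let avoid_sub (F : {fset set Gam}) C x y : [set` F] `<=` boundary C ->
  connected_in C -> C x -> C y -> reach (avoid F) C x y.
Proof.
move=> FC /connected_inP cC Cx Cy.
apply: (@reach_ind _ _ C (reach (avoid F) C x) x y); last exact: cC.
  exact: reach_refl.
move=> a b Ca Cb ab xa; apply: reach_trans xa _; apply: reach_step => //.
rewrite /avoid ab /=; apply/negP => /FC /boundary_pair.
by case=> -[].
Qed.

Let sep_step (F : {fset set Gam}) k :
  reach (avoid F) setT u v -> exists2 L : set (set Gam), finite_set L &
  sepcuts F k `<=` \bigcup_(e in L) [set C | e \notin F /\ sepcuts (e |` F)%fset k C].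
Proof.
case=> p [pp pl _]; exists [set [set x; y] | x in [set` u :: p] & y in [set` u :: p]].
  by apply: finite_image2; apply: finite_seq.
move=> C [cC Cu nCv FC leC].
have upv : reach (avoid F) [set` u :: p] u v by exists p.
have [x [y [ux yp nCy xy]]] := reach_exit upv Cu nCv.
have [xp Cx] := reach_inr ux.
have /andP[gxy nF] := xy.
exists [set x; y]; first by exists x => //; exists y.
split=> //; split=> // e /=; rewrite in_fset1U => /orP[/eqP->|/FC//].
exact: boundary_mk.
Qed.

(** Both sides stay connected when F is deleted, and u and v fall apart, so the
   side of u is exactly its component. *)
Let sep_unique (F : {fset set Gam}) k :
  ~ reach (avoid F) setT u v ->
  sepcuts F k `<=` [set reach (avoid F) setT u].
Proof.
move=> sep C [[_ _ cC cnC _] Cu nCv FC _]; apply/seteqP; split=> x.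
  by move=> Cx; apply: reach_sub (avoid_sub FC cC Cu Cx).
move=> ux; apply: contrapT => nCx; apply: sep; apply: reach_trans ux _.
have FnC : [set` F] `<=` boundary (~` C) by rewrite boundaryC.
exact: reach_sub (avoid_sub FnC cnC nCx nCv).
Qed.

(** Induction on the number j of boundary edges still unknown.  If some path from
   u to v avoids F, a cut separating u from v has a boundary edge outside F on
   that path, which joins F; otherwise the cut is determined by F. *)
Lemma finite_sepcuts j (F : {fset set Gam}) :
  finite_set (sepcuts F (#|` F| + j)).
Proof.
elim: j F => [|j IH] F;
  have [conn|sep] := pselect (reach (avoid F) setT u v);
  try by apply: sub_finite_set (sep_unique sep) _; exact: finite_set1.
- apply: (@sub_finite_set _ _ set0) => // C.
  have [L _ sub] := sep_step (#|` F| + 0) conn.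
  move=> /sub[e _ [eF [cC _ _ eFC]]]; rewrite addn0 leqNgt => /negP; apply.
  apply: (@leq_trans #|` (e |` F)%fset|).
    by rewrite cardfsU1 eF.
  rewrite -[X in X <= _]/(#|` _|) /ncard; apply: fsubset_leq_card.
  apply/fsubsetP => d dF; rewrite in_fset_set ?inE; last exact: finite_boundary.
  exact: eFC.
- have [L fL sub] := sep_step (#|` F| + j.+1) conn.
  apply: sub_finite_set sub _; apply: bigcup_finite => // e _.
  have [eF|eF] := boolP (e \in F); first by apply: (@sub_finite_set _ _ set0) => // C [].
  apply: sub_finite_set (IH (e |` F)%fset) => C [_]; rewrite cardfsU1 eF.
  by rewrite add1n addSn addnS.
Qed.

Lemma finite_kcuts_separating k : finite_set [set C | [/\ kcut k C, C u & ~ C v]].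
Proof.
have := finite_sepcuts k fset0; rewrite cardfs0; apply: sub_finite_set.
by move=> C [/kcutE[cC le] Cu nCv]; split.
Qed.

End Separating.

Definition splits (A C : set Gam) := exists u v, [/\ A u, A v, C u & ~ C v].

Lemma finite_kcuts_splitting k A : finite_set A ->
  finite_set [set C | kcut k C /\ splits A C].
Proof.
move=> fA; apply: (@sub_finite_set _ _
  (\bigcup_(u in A) \bigcup_(v in A) [set C | [/\ kcut k C, C u & ~ C v]])).
  by move=> C [kC [u [v [Au Av Cu nCv]]]]; exists u => //; exists v.
by apply: bigcup_finite => // u _; apply: bigcup_finite => // v _;
  apply: finite_kcuts_separating.
Qed.

Hypothesis conn : connected_graph Gam.

(** One side of D misses A, hence the ends of C, and, being connected, lies
   entirely on one side of C. *)
Lemma nested_unsplit A C D : ends C `<=` A -> cut D -> ~ splits A D ->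
  A !=set0 -> nested C D.
Proof.
move=> sub [_ _ /connected_inP cD /connected_inP cnD _] nsp [a Aa].
have side E : (forall x y, E x -> E y -> greach E x y) ->
    (forall x, A x -> ~ E x) -> E `<=` C \/ E `<=` ~` C.
  move=> cE AE; have [[x [Ex Cx]]|h] := pselect (exists x, E x /\ C x); last first.
    by right=> x Ex Cx; apply: h; exists x.
  left=> y Ey; apply: contrapT => nCy.
  have [z [t [xz Et nCt zt]]] := reach_exit (cE x y Ex Ey) Cx nCy.
  have [_ Cz] := reach_inr xz.
  by have [_ /sub/AE] := ends_mk zt Cz nCt.
have [Da|nDa] := pselect (D a).
  have AD x : A x -> ~ (~` D) x.
    by move=> Ax nDx; apply: nsp; exists a, x.
  by case: (side _ cnD AD) => h; [apply: Or43|apply: Or41];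
    move=> x Cx; apply: contrapT => /h // Cx'.
have AD x : A x -> ~ D x by move=> Ax Dx; apply: nsp; exists x, a.
case: (side _ cD AD) => h; [apply: Or44|apply: Or42] => x Cx Dx.
  exact: Cx (h x Dx).
exact: (h x Dx) Cx.
Qed.

(** A cut crossing C splits the connected hull of the ends of C. *)
Lemma finite_crossing k C : cut C -> finite_set (crossing k C).
Proof.
move=> cC; have fC := finite_ends (finite_boundary cC).
have [Z [fZ CZ cZ]] := finite_connected_hull conn fC.
have Z0 : Z !=set0.
  case: cC => C0 nC0 _ _ _; have [x xC] := ends_nonempty conn C0 nC0.
  by exists x; apply: CZ.
apply: sub_finite_set (finite_kcuts_splitting k fZ) => D [kD nn]; split=> //.
by apply: contrapT => nsp; apply/nn/(nested_unsplit CZ) => //; case: kD.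
Qed.

End FiniteCuts.

(** * Trees, tree decompositions and balanced cuts *)

Section Trees.
Variable T : sgraph.
Implicit Types (r s t z : T) (S : set T).

Local Notation treach := (reach (@adj T)).

Section Acyclic.
Hypothesis acyc : acyclic T.

(** Distinct neighbours of s lie in distinct components of the tree without s:
   a path joining them away from s would close up to a cycle through s. *)
Lemma tree_branch s r z : adj s r -> adj s z ->
  treach (~` [set s]) r z -> r = z.
Proof.
move=> sr sz rz; apply: contrapT => nrz.
have [p [pp pl pu pA]] := reach_shorten rz.
have : cycle (@adj T) [:: s, r & p].
  by rewrite /= rcons_path sr pp pl adj_sym.
apply/negP; apply: acyc; last first.
  by rewrite cons_uniq pu andbT; apply/negP => /pA; apply.
by case: p pl {pp pu pA} => //= rz'; case: nrz.
Qed.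

(** If the path entered S elsewhere, going around through S would join r to
   another neighbour of s while avoiding s. *)
Lemma tree_gate S r s t s' q : connected_in S ->
  ~ S r -> S s -> adj r s -> treach (~` S) r t ->
  S s' -> path (@adj T) t q -> last t q = s' -> s \in t :: q.
Proof.
move=> /connected_inP cS nSr Ss rs rt Ss' pq lq; apply: contrapT => nsq.
have s's : s' <> s by move=> e; apply: nsq; rewrite -e -lq mem_last.
have [x [y [s'x _ /contrapT ys xy]]] :=
  @reach_exit _ _ S (~` [set s]) s' s (cS _ _ Ss' Ss) s's (fun h => h erefl).
have [Sx _] := reach_inr s'x.
have rx : treach (~` [set s]) r x.
  apply: (@reach_trans _ _ _ t).
    by apply: reach_sub rt => z nSz zs; apply: nSz; rewrite zs.
  apply: (@reach_trans _ _ _ s').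
    by exists q; split=> // w wq ws; apply: nsq; rewrite -ws.
  by apply: reach_sub s'x => z [].
suff e : r = x by apply: nSr; rewrite e.
by apply: (@tree_branch s r x) => //; rewrite adj_sym // -ys.
Qed.

End Acyclic.

Section Distance.
Hypothesis conn : connected_graph T.

Lemma dist_ex t r :
  exists n, `[< exists p, [/\ path (@adj T) t p, last t p = r & size p = n] >].
Proof.
have [p [pp pl _]] := reachT conn t r.
by exists (size p); apply/asboolP; exists p.
Qed.

Definition dist t r := ex_minn (dist_ex t r).

Lemma dist_le t r p : path (@adj T) t p -> last t p = r -> dist t r <= size p.
Proof.
move=> pp pl; rewrite /dist; case: ex_minnP => n _; apply.
by apply/asboolP; exists p.
Qed.

Lemma dist_path t r : exists p,
  [/\ path (@adj T) t p, last t p = r, uniq (t :: p) & size p = dist t r].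
Proof.
have [p [pp pl ps]] : exists p,
    [/\ path (@adj T) t p, last t p = r & size p = dist t r].
  by rewrite /dist; case: ex_minnP => n /asboolP.
case/shortenP: pp pl => q qp qu qs ql; exists q; split=> //.
apply/eqP; rewrite eqn_leq dist_le // andbT -ps; apply: uniq_leq_size => //.
by case/andP: qu.
Qed.

Lemma geodesic_ex t r : exists p, geodesic t r p.
Proof.
have [p [pp pl _ ps]] := dist_path t r; exists p; split=> // q qp ql.
by rewrite ps dist_le.
Qed.

Lemma dist_adj s t r : adj s t -> dist s r <= (dist t r).+1.
Proof.
move=> st; have [p [pp pl _ <-]] := dist_path t r.
by rewrite -[(size p).+1]/(size (t :: p)) dist_le //= st.
Qed.

(** The first step from t towards r can only lead to s. *)
Lemma dist_branch s t r : acyclic T -> adj t s ->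
  treach (~` [set t]) s r -> dist t r = (dist s r).+1.
Proof.
move=> acyc ts sr; apply/eqP; rewrite eqn_leq dist_adj //=.
have [[|z p] [pp pl pu ps]] := dist_path t r.
  by case: (reach_inr sr); rewrite -pl.
move: pp pu ps => /= /andP[tz pp] /andP[tp _] <-.
suff -> : s = z by apply: dist_le.
apply: (tree_branch acyc ts tz); apply: reach_trans sr _; apply: reach_sym.
  exact: adj_sym.
by exists p; split=> // w wp wt; move: tp; rewrite -wt wp.
Qed.

End Distance.
End Trees.

Section TreeDecomposition.
Variables (Gam T : sgraph) (X : T -> {fset Gam}).
Hypothesis td : tree_decomposition X.
Implicit Types (s t : T) (S : set T) (v w x y : Gam) (K : set Gam).

Local Notation greach := (reach (@adj Gam)).
Local Notation treach := (reach (@adj T)).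

Let tconn : connected_graph T. Proof. by case: td => -[]. Qed.
Let tacyc : acyclic T. Proof. by case: td => -[]. Qed.

Lemma bag_of v : exists t, v \in X t.
Proof. by case: td => _ h _ _; apply: h. Qed.

Lemma bag_path v s t : v \in X s -> v \in X t ->
  exists p, [/\ path (@adj T) s p, last s p = t & forall r, r \in s :: p -> v \in X r].
Proof.
move=> vs vt; have [p gp] := geodesic_ex tconn s t.
case: (gp) => pp pl _; exists p; split=> // r rp.
by case: td => _ _ _ h; apply: h vs vt gp rp.
Qed.

(** The nodes carrying one vertex are connected, and adjacent vertices share a
   node; so a connected set of vertices is carried by a connected set of nodes. *)
Lemma bags_reach S K x y s t :
  (forall v r, K v -> S r -> v \notin X r) ->
  greach K x y -> x \in X s -> y \in X t -> treach (~` S) s t.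
Proof.
move=> KS xy xs yt.
have link v r r' : K v -> v \in X r -> v \in X r' -> treach (~` S) r r'.
  move=> Kv vr vr'; have [p [pp pl h]] := bag_path vr vr'.
  exists p; split=> // q qp Sq; have := KS _ _ Kv Sq.
  by rewrite h.
move: t yt; apply: (@reach_ind _ (@adj Gam) K
  (fun y => forall t, y \in X t -> treach (~` S) s t) x y) => // [t xt|].
  by apply: link xt => //; apply: reach_inl xy.
move=> v w Kv Kw vw IH t wt.
have [r /andP[vr wr]] : exists r, (v \in X r) && (w \in X r).
  by case: td => _ _ h _; apply: h.
by apply: reach_trans (IH _ vr) _; apply: link wt.
Qed.

Definition bags S : set Gam := \bigcup_(s in S) [set` X s].

(** The nodes carrying the component lie in one branch at S, attached at a node s.
   An attached vertex has a node in that branch and a node in S, and the path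
   between the two passes through s. *)
Lemma outer_bag S v : connected_in S -> S !=set0 -> ~ bags S v ->
  exists2 s, S s & outer (greach (~` bags S) v) `<=` [set` X s].
Proof.
move=> cS [s0 Ss0] nv; have [t0 vt0] := bag_of v.
have nSt0 : ~ S t0 by move=> St0; apply: nv; exists t0.
have avoid w r : (~` bags S) w -> S r -> w \notin X r.
  by move=> nw Sr; apply/negP => wr; apply: nw; exists r.
have [r [s [t0r _ /contrapT Ss rs]]] := @reach_exit _ _ setT (~` S) t0 s0
  (reachT tconn t0 s0) nSt0 (fun h => h Ss0).
have [_ nSr] := reach_inr t0r.
exists s => // y yK; have [_ [x vx xy]] := yK.
have [s' Ss' ys'] := outer_component yK.
have [t /andP[xt yt]] : exists t, (x \in X t) && (y \in X t).
  by case: td => _ _ h _; apply: h.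
have rt : treach (~` S) r t.
  apply: reach_trans (bags_reach avoid vx vt0 xt).
  by apply: reach_sym; [exact: adj_sym|apply: reach_sub t0r => z []].
have [q [pq lq yq]] := bag_path yt ys'.
by apply: yq; apply: (tree_gate tacyc cS nSr Ss rs rt Ss' pq lq).
Qed.

(** A median node, minimizing the sum of the distances to nodes carrying the
   vertices of W, is balanced: stepping into the branch of a component containing
   more than half of W would shorten the sum. *)
Lemma balanced_bag (W : seq Gam) : [set: Gam] !=set0 ->
  exists t, forall v, v \notin X t ->
    (count (fun w => `[< greach (~` [set` X t]) v w >]) W).*2 <= size W.
Proof.
move=> [v0 _]; have /choice[tw twP] := bag_of.
pose f t := \sum_(w <- W) dist tconn t (tw w).
have fex : exists n, `[< exists t, f t = n >].
  by exists (f (tw v0)); apply/asboolP; exists (tw v0).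
have [t tmin] : exists t, forall s, f t <= f s.
  have := ex_minnP fex; case: ex_minnP => n /asboolP[t <-] h _.
  by exists t => s; apply: h; apply/asboolP; exists s.
exists t => v vt; set K := fun w => _.
have avoid w r : (~` [set` X t]) w -> [set t] r -> w \notin X r.
  by move=> nw ->; apply/negP.
have [t0 vt0] := bag_of v.
have t0t : t0 <> t by move=> e; rewrite e (negbTE vt) in vt0.
have [s [t' [t0s _ /contrapT e st]]] := @reach_exit _ _ setT (~` [set t]) t0 t
  (reachT tconn t0 t) t0t (fun h => h erefl).
rewrite e in st.
have near w : K w -> dist tconn t (tw w) = (dist tconn s (tw w)).+1.
  move=> /asboolP vw; apply: dist_branch => //; first by rewrite adj_sym.
  apply: reach_trans (bags_reach avoid vw vt0 (twP w)).
  by apply: reach_sym; [exact: adj_sym|apply: reach_sub t0s => z []].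
have : f s + (count K W).*2 <= f t + size W.
  rewrite /f; elim: W {f fex tmin} => [|w W IH]; first by rewrite !big_nil.
  rewrite !big_cons /=; have := dist_adj tconn (tw w) st.
  by case Kw: (K w); [rewrite near //|]; lia.
by have := tmin s; lia.
Qed.

End TreeDecomposition.

Section Counts.

Lemma count_pigeonhole (T I : choiceType) (f : I -> pred T) (W : seq T) (L : seq I) n :
  (forall x, x \in W -> has (f^~ x) L) -> size L * n < size W ->
  exists2 y, y \in L & n < count (f y) W.
Proof.
move=> WL lt; apply: contrapT => h.
have le : count (fun x => has (f^~ x) L) W <= size L * n.
  have {}h y : y \in L -> count (f y) W <= n.
    by move=> yL; rewrite leqNgt; apply/negP => lty; apply: h; exists y.
  elim: L h {WL lt} => [|y L IH] h /=; first by rewrite count_pred0.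
  rewrite mulSn; apply: (@leq_trans (count (f y) W + count (fun x => has (f^~ x) L) W)).
    by rewrite -count_predUI leq_addr.
  apply: leq_add; first by apply: h; rewrite mem_head.
  by apply: IH => z zL; apply: h; rewrite inE zL orbT.
move: lt; rewrite ltnNge; case/negP; apply: leq_trans le.
by rewrite -[X in X <= _]count_predT; apply: eq_leq; apply: eq_in_count => x /WL ->.
Qed.

Lemma ncard_seq (T : choiceType) (A : set T) (s : seq T) :
  A `<=` [set` s] -> ncard A <= size s.
Proof.
move=> As; apply: uniq_leq_size; first exact: fset_uniq.
move=> x; rewrite in_fset_set ?inE; last exact: sub_finite_set As (finite_seq s).
exact: As.
Qed.

(** A lower bound on the size that makes sense for finite and infinite sets alike. *)
Definition many (T : choiceType) (n : nat) (A : set T) :=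
  exists s : seq T, [/\ uniq s, n <= size s & forall x, x \in s -> A x].

Lemma many_le (T : choiceType) m n (A : set T) : m <= n -> many n A -> many m A.
Proof. by move=> mn [s [? ? ?]]; exists s; split=> //; apply: leq_trans mn _. Qed.

Lemma many_finite (T : choiceType) (A : set T) : finite_set A -> exists n, ~ many n A.
Proof.
move=> fA; exists (ncard A).+1 => -[s [us le sA]]; move: le; rewrite ltnNge.
case/negP; apply: uniq_leq_size => // x /sA Ax.
by rewrite in_fset_set ?inE.
Qed.

Lemma infinite_many (T : choiceType) (A : set T) n : infinite_set A -> many n A.
Proof.
move=> /infinite_set_fset => /(_ n)[B BA le].
by exists (enum_fset B); split=> //; exact: fset_uniq.
Qed.

End Counts.

Section BoundedDegree.
Variable Gam : sgraph.
Hypothesis conn : connected_graph Gam.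
Hypothesis lf : locally_finite Gam.
Variable d : nat.
Hypothesis deg : forall v : Gam, ncard [set u | adj v u] <= d.
Implicit Types (A : set Gam) (F : {fset Gam}).

Local Notation greach := (reach (@adj Gam)).

Definition nbs (v : Gam) : seq Gam := fset_set [set u | adj v u].

Lemma mem_nbs v u : (u \in nbs v) = adj v u.
Proof.
by rewrite in_fset_set; [apply/idP/idP; rewrite inE|apply: lf].
Qed.

Lemma size_flatten_nbs (T : Type) (f : Gam -> Gam -> T) (s : seq Gam) :
  size (flatten [seq [seq f y u | u <- nbs y] | y <- s]) <= size s * d.
Proof.
elim: s => //= y s IH; rewrite size_cat mulSn size_map.
by apply: leq_add; [exact: deg|exact: IH].
Qed.

Lemma ncard_boundary A F : outer A `<=` [set` F] ->
  finite_set (boundary A) /\ ncard (boundary A) <= #|` F| * d.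
Proof.
move=> AF; set L := flatten [seq [seq [set y; u] | u <- nbs y] | y <- F].
have sub : boundary A `<=` [set` L].
  move=> e /boundaryP[u [v [uv Au nAv ->]]]; rewrite /= setUC.
  apply/flatten_mapP; exists v; first by apply: AF; split=> //; exists u.
  by apply/mapP; exists u => //; rewrite mem_nbs adj_sym.
split; first exact: sub_finite_set sub (finite_seq L).
by apply: leq_trans (ncard_seq sub) _; exact: size_flatten_nbs.
Qed.

Variables (T : sgraph) (X : T -> {fset Gam}) (m : nat).
Hypothesis td : tree_decomposition X.
Hypothesis width : forall t, #|` X t| <= m.

Lemma kcut_component A v t : connected_in A -> A !=set0 -> ~ A v ->
  outer A `<=` [set` X t] -> kcut (m * d) (greach (~` A) v).
Proof.
move=> cA A0 nAv AX; have [fA leA] := ncard_boundary AX.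
apply/kcutE; split; first exact: cut_component.
apply: leq_trans (ncard_sub fA (@boundary_component _ A v)) _.
by apply: leq_trans leA _; rewrite leq_mul2r width orbT.
Qed.

(** A cut C splitting alpha is replaced by a cheap one.  Let Y be the union of the
   bags over a finite subtree whose bags contain the ends of C.  Some component K
   outside Y contains infinitely many vertices of alpha in C.  It contains no end
   of C, so it lies in C, and it attaches to a single bag; a component of its
   complement containing infinitely many vertices of alpha outside C is the cut. *)
Lemma accessible_treewidth : accessible_with Gam (m * d).
Proof.
move=> alpha _; have [|/nonemptyPn] := pselect (cuts alpha !=set0); last by left.
move=> [C [cC infC infnC]]; right.
have fC := finite_ends (finite_boundary cC).
have [c Cc] : ends C !=set0.
  by case: cC => ? ? _ _ _; apply: ends_nonempty.
have /choice[tw twP] := bag_of td.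
have tconn : connected_graph T by case: td => -[].
have [S [fS CS cS]] := finite_connected_hull tconn (finite_image tw fC).
have S0 : S !=set0 by exists (tw c); apply: CS; exists c.
have CY : ends C `<=` bags X S
  by move=> x Cx; exists (tw x); [apply: CS; exists x|exact: twP].
have fY : finite_set (bags X S).
  by apply: bigcup_finite => // s _; apply: finite_fset.
have Y0 : bags X S !=set0 by exists c; apply: CY.
have foY : finite_set (outer (bags X S)).
  apply: sub_finite_set (finite_neighbours lf fY).
  by move=> y [_].
have [|v [nYv infK]] := component_pigeonhole conn Y0 foY (infinite_setD infC fY).
  by move=> x [].
set K := greach _ v in infK.
have [w [[[_ Cw] _] vw]] := infinite_setN0 infK.
have KC : K `<=` C.
  move=> x vx; apply: contrapT => nCx.
  have wx : greach (~` bags X S) w x by apply: reach_trans (reachC vw) vx.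
  have [y [z [wy _ nCz yz]]] := reach_exit wx Cw nCx.
  have [nYy Cy] := reach_inr wy.
  by have [/CY] := ends_mk yz Cy nCz.
have [s Ss Ks] := outer_bag td cS S0 nYv.
have cK : connected_in K by exact: connected_component.
have K0 : K !=set0 by exists w.
have foK : finite_set (outer K) by apply: sub_finite_set Ks _; apply: finite_fset.
have [|v2 [nKv2 infK2]] := component_pigeonhole conn K0 foK infnC.
  by move=> x [_ nCx] /KC.
have kK2 := kcut_component cK K0 nKv2 Ks.
exists (greach (~` K) v2) => //; split; first by case: kK2.
  by apply: sub_infinite_set infK2 => x [[]].
apply: sub_infinite_set infK => x [[[ax _] _] Kx]; split=> //.
exact: component_subC.
Qed.

(** A bag that balances a large finite part W of P leaves at most m * d components,
   so one of them, K, is rich in W, while at least half of W stays outside K.  The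
   complement of K has at most m components, so one of them is rich as well. *)
Lemma balanced_cut (P : set Gam) n : infinite_set P ->
  exists C, [/\ kcut (m * d) C, many n (P `&` C) & many n (P `&` ~` C)].
Proof.
move=> infP.
(* The three summands pay for the m * d components outside the bag, for the m
   components outside K among half of W, and for the vertices in the bag. *)
have [W [uW leW WP]] := infinite_many (m * d * n + 2 * m * n + m).+2 infP.
have Gam0 : [set: Gam] !=set0 by case: (infinite_setN0 infP) => x; exists x.
have [t bal] := balanced_bag td W Gam0.
have X0 : [set` X t] !=set0.
  apply: contrapT => /nonemptyPn e; have [v _] := Gam0.
  have vX : v \notin X t by apply/negP => vX; have : [set` X t] v by []; rewrite e.
  have := bal v vX; rewrite (eq_count (a2 := predT)) ?count_predT; first by lia.
  by move=> w /=; apply/asboolP; rewrite e setC0; apply: reachT.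
pose comp A v w := `[< greach (~` A) v w >].
have manyP A v : n <= count (comp A v) W -> many n (P `&` greach (~` A) v).
  move=> le; exists (filter (comp A v) W); rewrite filter_uniq // size_filter.
  by split=> // x; rewrite mem_filter => /andP[/asboolP vx /WP].
have [y yX nly] : exists2 y, outer [set` X t] y & n < count (comp [set` X t] y) W.
  pose L := flatten [seq [seq u | u <- nbs y] | y <- X t].
  pose W' := [seq x <- W | x \notin X t].
  have sW : size W <= size W' + m.
    rewrite size_filter -(count_predC (mem (X t)) W) addnC leq_add2l.
    apply: leq_trans (width t); rewrite -size_filter; apply: uniq_leq_size.
      exact: filter_uniq.
    by move=> x; rewrite mem_filter => /andP[].
  pose L' := [seq y <- L | y \notin X t].
  have sL : size L' <= m * d.
    rewrite size_filter; apply: leq_trans (count_size _ _) _.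
    apply: leq_trans (size_flatten_nbs (fun _ u => u) (X t)) _.
    by rewrite leq_mul2r width orbT.
  have inL y : outer [set` X t] y -> y \in L'.
    move=> [nXy [x Xx xy]]; rewrite mem_filter; apply/andP; split; first exact/negP.
    apply/flatten_mapP; exists x => //.
    by rewrite map_id mem_nbs.
  have L'P y : y \in L' -> outer [set` X t] y.
    rewrite mem_filter => /andP[/negP nXy /flatten_mapP[x Xx]].
    by rewrite map_id mem_nbs => xy; split=> //; exists x.
  have [||y yL lt] := @count_pigeonhole _ _ (comp [set` X t]) W' L' n.
  - move=> x; rewrite mem_filter => /andP[/negP nXx xW].
    have [y yX yx] := outer_reach conn X0 nXx.
    by apply/hasP; exists y; [exact: inL|apply/asboolP].
  - have := leq_mul sL (leqnn n); lia.
  exists y; first exact: L'P.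
  apply: leq_trans lt _; rewrite count_filter; apply: sub_count => x /=.
  by case/andP.
set K := greach (~` [set` X t]) y.
have nXy : y \notin X t by apply/negP; case: yX.
have cK : connected_in K by exact: connected_component.
have K0 : K !=set0 by exists y; apply: reach_refl; apply/negP.
have KX : outer K `<=` [set` X t] by exact: outer_component.
have [z zK nlz] : exists2 z, ~ K z & n < count (comp K z) W.
  pose W' := [seq x <- W | ~~ comp [set` X t] y x].
  pose L := [seq z <- X t | `[< outer K z >]].
  have sL : size L <= m.
    by rewrite size_filter; apply: leq_trans (count_size _ _) (width t).
  have sW : size W <= (size W').*2.
    rewrite size_filter -[count _ _]/(count (predC (comp [set` X t] y)) W).
    have := count_predC (comp [set` X t] y) W.
    have : (count (comp [set` X t] y) W).*2 <= size W by exact: bal.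
    lia.
  have [||z zL lt] := @count_pigeonhole _ _ (comp K) W' L n.
  - move=> x; rewrite mem_filter => /andP[/asboolP nKx xW].
    have [z zK zx] := outer_reach conn K0 nKx.
    apply/hasP; exists z; last exact/asboolP.
    by rewrite mem_filter KX // andbT; apply/asboolP.
  - have := leq_mul sL (leqnn n); lia.
  exists z; first by move: zL; rewrite mem_filter => /andP[/asboolP[]].
  apply: leq_trans lt _; rewrite count_filter; apply: sub_count => x /=.
  by case/andP.
exists (greach (~` K) z); split.
- exact: kcut_component zK KX.
- by apply: manyP; apply: ltnW.
- have [s [us ls sP]] := manyP [set` X t] y (ltnW nly).
  exists s; split=> // x /sP[Px Kx]; split=> //; exact: component_subC.
Qed.

End BoundedDegree.

(** * Optimal cuts are nested *)

Section Nested.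
Variable U : Type.
Implicit Types C D F : set U.

Lemma setC_sub C D : ~` C `<=` D -> ~` D `<=` C.
Proof. by move=> h x nDx; apply: contrapT => /h. Qed.

Lemma sub_setCC C D : C `<=` ~` D -> D `<=` ~` C.
Proof. by move=> h x Dx /h. Qed.

End Nested.

Section NestedCorners.
Variable Gam : sgraph.
Implicit Types C D F : set Gam.

Lemma nested_sym C D : nested C D -> nested D C.
Proof.
case=> h.
- by apply: Or44 => x nDx /h.
- by apply: Or42; exact: sub_setCC.
- by apply: Or43; exact: setC_sub.
- by apply: Or41 => x Dx; apply: contrapT => /h.
Qed.

Lemma nestedCl C D : nested (~` C) D -> nested C D.
Proof.
by case=> h; [apply: Or43|apply: Or44|apply: Or41|apply: Or42];
  rewrite ?setCK // in h *.
Qed.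

Lemma nestedCr C D : nested C (~` D) -> nested C D.
Proof. by move=> /nested_sym/nestedCl/nested_sym. Qed.

Lemma nested_corner C D F : ~ nested C D -> nested C F -> nested D F ->
  nested (C `&` D) F.
Proof.
move=> nn [] h; try by [move=> _; apply: Or41 => x [/h]|move=> _; apply: Or42 => x [/h]].
- case=> h'; try by [apply: Or41 => x [_ /h']|apply: Or42 => x [_ /h']].
    by apply: Or43; rewrite setCI => x [/h|/h'].
  by case: nn; apply: Or43 => x /h Fx; apply: contrapT => /h'.
- case=> h'; try by [apply: Or41 => x [_ /h']|apply: Or42 => x [_ /h']].
    by case: nn; apply: Or43 => x /h nFx; apply: contrapT => /h'.
  by apply: Or44; rewrite setCI => x [/h|/h'].
Qed.

Lemma nested_opposite C D F : nested C F ->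
  nested (C `&` D) F \/ nested (~` C `&` ~` D) F.
Proof.
case=> h; [left; apply: Or41|left; apply: Or42|right; apply: Or41|right; apply: Or42];
  by move=> x [/h].
Qed.

(** As C and D cross, a cut nested with both is nested with all their corners. *)
Lemma crossing_corners k C D : ~ nested C D ->
  crossing k (C `&` D) `|` crossing k (~` C `&` ~` D) `<=`
    crossing k C `|` crossing k D.
Proof.
move=> nn F h; have [kF] : kcut k F /\ (~ nested (C `&` D) F \/ ~ nested (~` C `&` ~` D) F).
  by case: h => -[kF h]; split; auto.
move=> {}h; have [CF|nCF] := pselect (nested C F); last by left.
right; split=> // DF; case: h; apply; first exact: nested_corner.
apply: nested_corner.
- by move=> /nestedCl/nestedCr.
- by apply: nestedCl; rewrite setCK.
- by apply: nestedCl; rewrite setCK.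
Qed.

(** A side of C lies within a side of any cut nested with C, and each side of C
   contains one of the two opposite corners. *)
Lemma crossing_both_corners k C D :
  crossing k (C `&` D) `&` crossing k (~` C `&` ~` D) `<=`
    crossing k C `&` crossing k D.
Proof.
move=> F [[kF h1] [_ h2]]; split; split=> // h.
  by case: (nested_opposite D h).
by case: (nested_opposite C h); rewrite setIC.
Qed.

Lemma boundary_corners C D :
  boundary (C `&` D) `|` boundary (~` C `&` ~` D) `<=` boundary C `|` boundary D.
Proof.
move=> e [] /boundaryP[u [v [uv [Cu Du] nv ->]]].
  have [Cv|nCv] := pselect (C v); last by left; apply: boundary_mk.
  by right; apply: boundary_mk => // Dv; apply: nv.
have [Cv|nCv] := pselect (C v); first by left; apply: boundary_mk2.
by right; apply: boundary_mk2 => //; apply: contrapT => nDv; apply: nv.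
Qed.

(** An edge leaving both of two opposite corners runs from one to the other. *)
Lemma boundary_both_corners C D :
  boundary (C `&` D) `&` boundary (~` C `&` ~` D) `<=` boundary C `&` boundary D.
Proof.
move=> e [/boundaryP[u [v [uv [Cu Du] _ ->]]]].
by case/boundary_pair => -[]; [case|move=> _ [nCv nDv]; split; apply: boundary_mk].
Qed.

End NestedCorners.

Section OptimalCuts.
Variable Gam : sgraph.
Hypothesis conn : connected_graph Gam.
Variable k : nat.
Hypothesis acc : accessible_with Gam k.
Implicit Types (alpha beta : int -> Gam) (C D E : set Gam).

Local Notation greach := (reach (@adj Gam)).

Lemma ex_argmin (S : Type) (P : S -> Prop) (f : S -> nat) :
  (exists x, P x) -> exists2 x, P x & forall y, P y -> f x <= f y.
Proof.
move=> [x0 Px0]; have ex : exists n, `[< exists2 x, P x & f x = n >].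
  by exists (f x0); apply/asboolP; exists x0.
case: (ex_minnP ex) => n /asboolP[x Px <-] h; exists x => // y Py.
by apply: h; apply/asboolP; exists y.
Qed.

Lemma min_le alpha C D : cuts_min alpha C -> cuts alpha D ->
  ncard (boundary C) <= ncard (boundary D).
Proof.
move=> [_ hC] cD; apply: ncard_le (hC _ cD); apply: finite_boundary.
by case: cD.
Qed.

Lemma minP alpha C : cuts alpha C ->
  (forall D, cuts alpha D -> ncard (boundary C) <= ncard (boundary D)) ->
  cuts_min alpha C.
Proof.
move=> cC h; split=> // D cD; apply: le_ncard (h D cD); apply: finite_boundary.
  by case: cC.
by case: cD.
Qed.

Lemma min_kcut alpha C : biinfinite_path alpha -> cuts_min alpha C -> kcut k C.
Proof.
move=> /acc [e [cC _]|[D cD [_ kD]] [cC hC]]; first by rewrite e in cC.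
by split; [case: cC|apply: card_le_trans (hC D cD) kD].
Qed.

Lemma min_cut alpha C : cuts_min alpha C -> cut C.
Proof. by case=> -[]. Qed.

Lemma opt_kcut C : cuts_opt Gam k C -> kcut k C.
Proof. by case=> alpha ha [/(min_kcut ha)]. Qed.

Lemma opt_cut C : cuts_opt Gam k C -> cut C.
Proof. by move=> /opt_kcut[]. Qed.

Lemma opt_le alpha C D : cuts_opt_for k alpha C -> cuts_min alpha D ->
  ncard (crossing k C) <= ncard (crossing k D).
Proof.
move=> [_ h] mD; apply: ncard_le (h D mD).
by apply: finite_crossing => //; exact: min_cut mD.
Qed.

Lemma optP alpha C : cuts_min alpha C ->
  (forall D, cuts_min alpha D -> ncard (crossing k C) <= ncard (crossing k D)) ->
  cuts_opt_for k alpha C.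
Proof.
move=> mC h; split=> // D mD.
by apply: le_ncard (h D mD); apply: finite_crossing => //; apply: min_cut; eassumption.
Qed.

Lemma opt_exists alpha : cuts alpha !=set0 -> exists C, cuts_opt_for k alpha C.
Proof.
move=> /(ex_argmin (fun C => ncard (boundary C)))[C cC minC].
have /(ex_argmin (fun C => ncard (crossing k C)))[D mD minD] :
    exists C, cuts_min alpha C by exists C; apply: minP.
by exists D; apply: optP.
Qed.

Lemma opt_forC alpha C : cuts_opt_for k alpha C -> cuts_opt_for k alpha (~` C).
Proof. by move=> [mC h]; split; [exact: cuts_minC|rewrite crossingC]. Qed.

(** The complement of a corner is connected since C and D do not cover the graph.
   The corner itself may be disconnected; a component met infinitely often by
   alpha is a cut with a smaller boundary, unless it is the whole corner. *)
Lemma corner_cut alpha C D : cuts alpha C -> cut D -> (~` C `&` ~` D) !=set0 ->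
  infinite_set (range alpha `&` (C `&` D)) ->
  exists K, [/\ cuts alpha K, boundary K `<=` boundary (C `&` D) &
                boundary (C `&` D) `<=` boundary K -> C `&` D = K].
Proof.
move=> [cC _ infnC] cD ne inf.
have cA : connected_in (~` (C `&` D)).
  by rewrite setCI; apply: connectedU => //; [case: cC|case: cD].
have A0 : ~` (C `&` D) !=set0.
  by case: ne => x [nCx _]; exists x => -[].
have fb : finite_set (boundary (C `&` D)).
  apply: (@sub_finite_set _ _ (boundary C `|` boundary D)).
    by apply: subset_trans (@boundary_corners _ C D); exact: subsetUl.
  by rewrite finite_setU; split; exact: finite_boundary.
have fo : finite_set (outer (~` (C `&` D))).
  apply: sub_finite_set (@outer_sub_ends _ _) _.
  by apply: finite_ends; rewrite boundaryC.
have [|v [nAv infK]] := component_pigeonhole conn A0 fo inf.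
  by move=> x [_ CDx] /(_ CDx).
exists (greach (~` ~` (C `&` D)) v); split.
- split.
  + by apply: cut_component; rewrite ?boundaryC.
  + by apply: sub_infinite_set infK => x [[]].
  + apply: sub_infinite_set infnC => x [ax nCx]; split=> // /reach_inr.
    by rewrite setCK => -[].
- by rewrite -(boundaryC (C `&` D)); exact: boundary_component.
- move=> h; rewrite -[LHS]setCK; apply: component_whole => //.
  by rewrite boundaryC.
Qed.

(** Submodularity, applied first to the boundaries and then to the crossing
   numbers.  The first shows that the corners are cuts minimal for alpha and
   beta; by the second they cross together strictly fewer k-cuts than C and D do,
   as C crosses D but neither corner. *)
Lemma no_opposite_corners alpha beta C D :
  biinfinite_path alpha -> biinfinite_path beta ->
  cuts_opt_for k alpha C -> cuts_opt_for k beta D -> ~ nested C D ->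
  infinite_set (range alpha `&` (C `&` D)) ->
  ~ infinite_set (range beta `&` (~` C `&` ~` D)).
Proof.
move=> ha hb oC oD nn infa infb.
have mC : cuts_min alpha C by case: oC.
have mD : cuts_min beta D by case: oD.
have [cC cD] := (min_cut mC, min_cut mD).
have [cutsC' cutsD'] : cuts alpha C /\ cuts beta D by case: mC; case: mD.
have [K [cK bK wK]] : exists K, [/\ cuts alpha K, boundary K `<=` boundary (C `&` D) &
                boundary (C `&` D) `<=` boundary K -> C `&` D = K].
  by apply: corner_cut => //; case: (infinite_setN0 infb) => x [_ ?]; exists x.
have [L [cL bL wL]] : exists K, [/\ cuts beta K,
    boundary K `<=` boundary (~` C `&` ~` D) &
    boundary (~` C `&` ~` D) `<=` boundary K -> ~` C `&` ~` D = K].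
  rewrite [~` C `&` _]setIC in infb *; apply: corner_cut => //.
  - exact: cutsC.
  - exact: cutC.
  - by rewrite !setCK setIC; case: (infinite_setN0 infa) => x [_ ?]; exists x.
have [fC fD] := (finite_boundary cC, finite_boundary cD).
have fU : finite_set (boundary C `|` boundary D) by rewrite finite_setU.
have sub := @boundary_corners _ C D.
have fE : finite_set (boundary (C `&` D)).
  by apply: sub_finite_set fU; apply: subset_trans sub; exact: subsetUl.
have fE' : finite_set (boundary (~` C `&` ~` D)).
  by apply: sub_finite_set fU; apply: subset_trans sub; exact: subsetUr.
have le := ncard_uncross fC fD sub (@boundary_both_corners _ C D).
have leK := ncard_sub fE bK.
have leL := ncard_sub fE' bL.
have leC := min_le mC cK; have leD := min_le mD cL.
have eK : C `&` D = K.
  by apply: wK; rewrite (ncard_sub_eq fE bK) //; lia.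
have eL : ~` C `&` ~` D = L.
  by apply: wL; rewrite (ncard_sub_eq fE' bL) //; lia.
rewrite -eK in cK leC; rewrite -eL in cL leD.
have mE : cuts_min alpha (C `&` D).
  by apply: minP => // F /(min_le mC); lia.
have mE' : cuts_min beta (~` C `&` ~` D).
  by apply: minP => // F /(min_le mD); lia.
have := opt_le oC mE; have := opt_le oD mE'.
suff : ncard (crossing k (C `&` D)) + ncard (crossing k (~` C `&` ~` D)) <
       ncard (crossing k C) + ncard (crossing k D) by lia.
apply: (@ncard_uncross_lt _ _ _ _ _ C).
- exact: finite_crossing.
- exact: finite_crossing.
- exact: crossing_corners.
- exact: crossing_both_corners.
- by right; split; [exact: min_kcut mC|move/nested_sym].
- case=> -[_]; apply; first by apply: Or41 => x [].
  by apply: Or42 => x [].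
Qed.

Lemma infinite_split (P : set Gam) C : infinite_set P ->
  infinite_set (P `&` C) \/ infinite_set (P `&` ~` C).
Proof.
move=> infP; have [fin|] := pselect (finite_set (P `&` C)); last by left.
right=> fin'; apply: infP; rewrite -(setIT P) -(setUv C) setIUr finite_setU.
by split.
Qed.

(** If no pair of opposite corners is shared by the two paths, then all four
   corners are hit, each path running between opposite ones.  Then D is optimal
   for alpha as well, and alpha alone supplies both corners. *)
Lemma opt_nested C D : cuts_opt Gam k C -> cuts_opt Gam k D -> nested C D.
Proof.
move=> [alpha ha oC] [beta hb oD]; apply: contrapT => nn.
have nn' : ~ nested C (~` D) by move=> /nestedCr.
have [[cC aC anC] minC] := oC.1; have [[cD bD bnD] minD] := oD.1.
have oD' := opt_forC oD.
(* All four corners are met, alpha running between two opposite ones and beta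
   between the other two. *)
have all_corners A (oA : cuts_opt_for k beta A) : ~ nested C A ->
    infinite_set (range alpha `&` (C `&` A)) ->
    infinite_set (range alpha `&` (~` C `&` ~` A)) ->
    infinite_set (range beta `&` (~` C `&` A)) ->
    infinite_set (range beta `&` (C `&` ~` A)) -> False.
  move=> nnA a1 a2 b1 b2.
  have cA : cut A by case: oA => -[[]].
  have cutaA : cuts alpha A.
    split=> //; first by apply: sub_infinite_set a1 => x [? []].
    by apply: sub_infinite_set a2 => x [? []].
  have cutbC : cuts beta C.
    split=> //; first by apply: sub_infinite_set b2 => x [? []].
    by apply: sub_infinite_set b1 => x [? []].
  have leCA := min_le oC.1 cutaA; have leAC := min_le oA.1 cutbC.
  have mA : cuts_min alpha A.
    by apply: minP => // F cF; apply: leq_trans leAC (min_le oC.1 cF).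
  have mC : cuts_min beta C.
    by apply: minP => // F cF; apply: leq_trans leCA (min_le oA.1 cF).
  have oA' : cuts_opt_for k alpha A.
    apply: optP => // F mF; apply: leq_trans (opt_le oA mC) _.
    exact: opt_le oC mF.
  exact: (no_opposite_corners ha ha oC oA' nnA a1 a2).
(* Up to replacing D by its complement, alpha meets the first corner
   infinitely often. *)
have run A (oA : cuts_opt_for k beta A) : ~ nested C A ->
    infinite_set (range alpha `&` (C `&` A)) -> False.
  move=> nnA a1; have oAC := opt_forC oA; have oCC := opt_forC oC.
  have [[_ bA bnA] _] := oA.1.
  have nnAC : ~ nested (~` C) (~` A) by move=> /nestedCl/nestedCr.
  have nnC : ~ nested (~` C) A by move=> /nestedCl.
  have [b2|] := infinite_split C bnA; last first.
    by rewrite -setIA [~` A `&` _]setIC; apply: (no_opposite_corners ha hb oC oA).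
  have [a2|a2] := infinite_split A anC.
    apply: (no_opposite_corners ha hb oCC oA nnC (_ : infinite_set (_ `&` (_ `&` _)))).
      by rewrite setIA; exact: a2.
    by rewrite setCK [C `&` _]setIC setIA.
  have [b1|b1] := infinite_split C bA.
    apply: (no_opposite_corners ha hb oCC oAC nnAC (_ : infinite_set (_ `&` (_ `&` _)))).
      by rewrite setIA; exact: a2.
    by rewrite !setCK [C `&` _]setIC setIA.
  apply: (all_corners A) => //.
  - by rewrite setIA.
  - by rewrite [~` C `&` _]setIC setIA.
  - by rewrite [C `&` _]setIC setIA.
have [a1|a1] := infinite_split D aC; first by apply: (run D) => //; rewrite setIA.
by apply: (run (~` D)) => //; rewrite setIA.
Qed.

End OptimalCuts.

(** * The structure tree *)

Section StructureTree.
Variable Gam : sgraph.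
Hypothesis conn : connected_graph Gam.
Variable k : nat.
Hypothesis acc : accessible_with Gam k.
Implicit Types C D E F : set Gam.

Local Notation opt := (cuts_opt Gam k).

Lemma opt0 C : opt C -> C !=set0.
Proof. by move=> /(opt_cut acc)[]. Qed.

Lemma opt_cover C D : opt C -> opt D -> ~ (~` C `<=` D /\ ~` C `<=` ~` D).
Proof.
by move=> /cuts_optC/opt0[x nCx] _ [h h']; apply: (h' x nCx); apply: h.
Qed.

Lemma opt_top C D : opt D -> C `<=` D -> ~` C `<=` D -> False.
Proof.
move=> /cuts_optC/opt0[x nDx] CD nCD; apply: nDx.
by have [/CD|/nCD] := pselect (C x).
Qed.

Lemma strict_subsetP C D : C `<` D <-> C `<=` D /\ C <> D.
Proof.
by rewrite properEneq; split=> [[/eqP]|[? /eqP]].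
Qed.

Lemma sim_refl C : cut_sim k C C. Proof. by left. Qed.

Lemma sim_sym C D : opt C -> opt D -> cut_sim k C D -> cut_sim k D C.
Proof.
move=> oC oD [->|[/strict_subsetP[sub ne] cover]]; [exact: sim_refl|right].
split.
  apply/strict_subsetP; split; first exact: setC_sub.
  by move=> e; apply: ne; rewrite -e setCK.
move=> F oF /strict_subsetP[subF neF] FC.
apply: contrapT => neFC; apply: neF; rewrite -[RHS]setCK; congr (~` _).
apply/esym/cover; first exact: cuts_optC.
  apply/strict_subsetP; split; first exact: subsetC.
  by move=> e; apply: neFC; rewrite -[LHS]setCK -e setCK.
exact: setC_sub.
Qed.

(** Nestedness decides the position of C relative to E, and of any cut in
   between relative to D; all cases but the desired ones contradict that D
   covers the complement of C and E covers the complement of D. *)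
Lemma sim_trans C D E : opt C -> opt D -> opt E ->
  cut_sim k C D -> cut_sim k D E -> cut_sim k C E.
Proof.
move=> oC oD oE CD DE.
have DC := sim_sym oC oD CD.
case: CD => [->//|[/strict_subsetP[CD nCD] coverCD]].
case: DE => [<-|[/strict_subsetP[DE nDE] coverDE]];
  first by right; split=> //; apply/strict_subsetP.
case: DC => [e|[DCp coverDC]]; first by rewrite -e; right; split=> //; apply/strict_subsetP.
have [DC _] := (strict_subsetP _ _).1 DCp.
have [->|/eqP CE] := eqVneq C E; first exact: sim_refl.
right; split.
  apply/strict_subsetP; split; last first.
    move=> e; apply: (@opt_cover D D) => //; split=> //.
    by apply: subset_trans DE _; rewrite -e.
  case: (opt_nested conn acc oC oE) => h //.
  - by case: CE; apply: coverDE.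
  - by case: (@opt_cover D E) => //; split=> //; apply: subset_trans h.
  - case: CE; apply/esym/coverDC => //; first exact/strict_subsetP.
    by move=> x Ex; apply: contrapT => /h.
move=> F oF CFp FE; have [CF _] := (strict_subsetP _ _).1 CFp.
case: (opt_nested conn acc oF oD) => h.
- have e := coverCD F oF CFp h.
  by case: (@opt_top D E) => //; rewrite -e.
- by case: (@opt_cover C D) => //; split=> //; apply: subset_trans h.
- have [e|/eqP ne] := eqVneq (~` D) F.
    by case: (@opt_cover C D) => //; split=> //; rewrite e.
  apply: coverDE => //; apply/strict_subsetP; split=> //; exact: setC_sub.
- case: (@opt_top D E) => //; apply: subset_trans FE.
  by move=> x Dx; apply: contrapT => /h.
Qed.

Lemma class_eq C D : opt C -> opt D ->
  cut_class k C = cut_class k D <-> cut_sim k C D.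
Proof.
move=> oC oD; split=> [e|CD].
  have : cut_class k D D by split=> //; exact: sim_refl.
  by rewrite -e => -[].
apply/seteqP; split=> E [oE h]; split=> //.
  exact: sim_trans (sim_sym oC oD CD) h.
exact: sim_trans CD h.
Qed.

Definition between C D : set (set Gam) := [set E | [/\ opt E, C `<=` E & E `<=` D]].

Lemma finite_between C D : C !=set0 -> ~` D !=set0 -> finite_set (between C D).
Proof.
move=> [u Cu] [v nDv].
apply: sub_finite_set (finite_kcuts_separating u v k) => E [oE CE ED].
by split; [exact: opt_kcut oE|exact: CE|move=> /ED].
Qed.

Lemma opt_between C D : opt C -> opt D -> finite_set (between (~` C) D).
Proof. by move=> oC oD; apply: finite_between; apply: opt0; exact: cuts_optC. Qed.

(** A minimal element of a finite interval covers its lower end. *)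
Lemma cover_exists C E : opt C -> opt E -> ~` C `<` E ->
  exists F, [/\ opt F, cut_sim k C F & F `<=` E].
Proof.
move=> oC oE CE.
have [|F [oF CF FE] minF] :=
  @ex_argmin _ (fun F => [/\ opt F, ~` C `<` F & F `<=` E])
    (fun F => ncard (between (~` C) F)).
  by exists E; split.
exists F; split=> //; right; split=> // D oD CD DF.
have sub : between (~` C) D `<=` between (~` C) F.
  by move=> B [oB CB BD]; split=> //; apply: subset_trans DF.
have e := ncard_sub_eq (opt_between oC oF) sub (minF D (And3 oD CD (subset_trans DF FE))).
have [_ _ FD] : between (~` C) D F.
  by rewrite e; split=> //; case/strict_subsetP: CF.
by apply/seteqP; split.
Qed.

Local Notation T := (structure_tree Gam k).
Implicit Types e f : st_edge Gam k.

Definition edge_of C (oC : opt C) : st_edge Gam k := SigSub (mem_set oC).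

Lemma st_opt e : opt (st_cut e). Proof. exact: set_valP. Qed.

Lemma st_class_eq e f :
  st_class e = st_class f <-> cut_sim k (st_cut e) (st_cut f).
Proof.
rewrite -class_eq; [|exact: st_opt|exact: st_opt].
by split=> [/(congr1 val)|h]; last exact: val_inj.
Qed.

Lemma st_class_ex (x : st_vertex Gam k) : exists e, st_class e = x.
Proof.
have [C oC eC] := set_valP x.
by exists (edge_of oC); apply: val_inj.
Qed.

Lemma st_cut_inv e : st_cut (st_inv e) = ~` st_cut e.
Proof. by []. Qed.

Lemma st_loopless e : st_class e <> st_class (st_inv e).
Proof.
move=> /st_class_eq[h|[/strict_subsetP[h ne] _]]; last exact: ne.
by apply: (cuts_opt_neqC (st_opt e)); rewrite -st_cut_inv.
Qed.

Lemma st_adj e : @adj (underlying T) (st_class e) (st_class (st_inv e)).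
Proof.
apply/andP; split; first exact/eqP/st_loopless.
by apply/asboolP; exists e.
Qed.

Lemma st_simple e f : st_class e = st_class f ->
  st_class (st_inv e) = st_class (st_inv f) -> e = f.
Proof.
move=> /st_class_eq[h _|[/strict_subsetP[h ne] _]]; first exact: val_inj.
case/st_class_eq=> [h'|[/strict_subsetP[h' ne'] _]]; first exact/val_inj/(can_inj (@setCK _)).
rewrite !st_cut_inv setCK in h'.
by case: ne; apply/seteqP; split=> //; exact: sub_setCC.
Qed.

Local Notation treach := (reach (@adj (underlying T)) setT).

(** Induction on the interval: pass to a cover F of the complement of e below f,
   which has the same class as e, and cross the edge F. *)
Lemma st_reach_up e f : ~` st_cut e `<` st_cut f -> treach (st_class e) (st_class f).
Proof.
have [n] := ubnP (ncard (between (~` st_cut e) (st_cut f))).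
elim: n e => // n IH e; rewrite ltnS => le ef.
have [F [oF eF Ff]] := cover_exists (st_opt e) (st_opt f) ef.
have -> : st_class e = st_class (edge_of oF) by exact/st_class_eq.
have [->|/eqP ne] := eqVneq (edge_of oF) f; first exact: reach_refl.
apply: (@reach_trans _ _ _ (st_class (st_inv (edge_of oF)))).
  by apply: reach_step => //; apply: st_adj.
apply: IH; last first.
  rewrite st_cut_inv setCK; apply/strict_subsetP; split=> // h; apply: ne; exact: val_inj.
apply: leq_trans le; rewrite st_cut_inv setCK ltnNge; apply/negP => le.
have subF : ~` st_cut e `<` F.
  case: eF => [h|[]//]; case/strict_subsetP: ef => sub ne'.
  case: (@opt_top (st_cut e) (st_cut f)) => //; try exact: st_opt.
  by rewrite h.
have [sub nsub] := subF.
have sub' : between F (st_cut f) `<=` between (~` st_cut e) (st_cut f).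
  by move=> B [oB FB Bf]; split=> //; apply: subset_trans FB.
have eq := ncard_sub_eq (opt_between (st_opt e) (st_opt f)) sub' le.
have : between (~` st_cut e) (st_cut f) (~` st_cut e).
  by split=> //; [exact/cuts_optC/st_opt|case/strict_subsetP: ef].
by rewrite -eq => -[_ /nsub].
Qed.

Lemma st_reach_le e f : ~` st_cut e `<=` st_cut f -> treach (st_class e) (st_class f).
Proof.
have [h _|/eqP ne sub] := eqVneq (~` st_cut e) (st_cut f); last first.
  by apply: st_reach_up; apply/strict_subsetP.
have -> : f = st_inv e by apply: val_inj.
by apply: reach_step => //; apply: st_adj.
Qed.

Lemma st_connected : connected_graph (underlying T).
Proof.
apply/connected_inP => x y _ _.
have [e <-] := st_class_ex x; have [f <-] := st_class_ex y.
have flip g : treach (st_class g) (st_class (st_inv g)).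
  by apply: reach_step => //; apply: st_adj.
have flip' g : treach (st_class (st_inv g)) (st_class g).
  by apply: reach_sym; [exact: adj_sym|exact: flip].
case: (opt_nested conn acc (st_opt e) (st_opt f)) => h.
- by apply: reach_trans (flip e) _; apply: st_reach_le; rewrite st_cut_inv setCK.
- apply: reach_trans (flip e) _; apply: reach_trans (flip' f).
  by apply: st_reach_le; rewrite !st_cut_inv setCK.
- exact: st_reach_le.
- by apply: reach_trans (flip' f); apply: st_reach_le.
Qed.

Lemma next_next (V : eqType) (c : seq V) x : 3 <= size c -> uniq c ->
  x \in c -> next c (next c x) != x.
Proof.
move=> sc uc xc; have [i c' rc] := rot_to xc.
have e y : next c y = next (rot i c) y by rewrite next_rot.
rewrite !{}e; move: sc uc; rewrite -(size_rot i) -(rot_uniq i) rc.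
case: c' {rc} => [|y [|z c']] //= _; rewrite eqxx !inE !negb_or.
case/and3P=> /and3P[xy xz _] /andP[yz _] _.
by rewrite [y == x]eq_sym (negbTE xy) eqxx eq_sym.
Qed.

(** Around a cycle without backtracking the cuts would strictly increase. *)
Lemma st_acyclic : acyclic (underlying T).
Proof.
move=> c sc uc; apply/negP => cc.
have /choice[ed edP] : forall x : dvertex T, exists e, x \in c ->
    st_class e = x /\ st_class (st_inv e) = next c x.
  move=> x; have [xc|_] := boolP (x \in c); last first.
    by have [e _] := st_class_ex x; exists e.
  by have /andP[_ /asboolP[e [se te]]] := next_cycle cc xc; exists e.
pose lt x y := `[< st_cut (ed x) `<` st_cut (ed y) >].
have : cycle lt c.
  apply: cycle_from_next => // x xc; apply/asboolP.
  have nxc : next c x \in c by rewrite mem_next.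
  have [sx tx] := edP x xc; have [sy ty] := edP _ nxc.
  have : st_class (st_inv (ed x)) = st_class (ed (next c x)) by rewrite tx sy.
  move/st_class_eq; case=> [h|[]]; last by rewrite st_cut_inv setCK.
  have eq : st_inv (ed x) = ed (next c x) by apply: val_inj.
  have := next_next sc uc xc.
  by rewrite -ty -eq st_invK sx eqxx.
rewrite cycle_all2rel => [/allrelP|y x z]; last first.
  move=> /asboolP[xy nyx] /asboolP[yz _]; apply/asboolP; split.
    exact: subset_trans yz.
  by move=> zx; apply: nyx; apply: subset_trans zx.
case: c sc {uc cc edP} => // x c _ /(_ x x (mem_head _ _) (mem_head _ _)).
by move=> /asboolP/strict_subsetP[].
Qed.

Lemma st_tree : dgraph_tree T.
Proof.
split; [exact: st_loopless|exact: st_simple|].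
by split; [exact: st_connected|exact: st_acyclic].
Qed.

End StructureTree.

(** * The action on cuts and on the structure tree *)

Section Action.
Variables (G : groupType) (S : Type) (s : G -> S -> S).
Hypothesis sP : is_action s.
Implicit Types (g h : G) (x y : S) (A B : set S).

Lemma act1 x : s 1%g x = x. Proof. exact: sP.1. Qed.
Lemma actM g h x : s (g * h)%g x = s g (s h x). Proof. exact: sP.2. Qed.
Lemma actK g : cancel (s g) (s g^-1%g).
Proof. by move=> x; rewrite -actM mulVg act1. Qed.
Lemma actVK g : cancel (s g^-1%g) (s g).
Proof. by move=> x; rewrite -actM mulgV act1. Qed.
Lemma act_inj g : injective (s g). Proof. exact: can_inj (actK g). Qed.

Lemma set_actE g A x : set_action s g A x <-> A (s g^-1%g x).
Proof.
split=> [[y Ay <-]|Ax]; first by rewrite actK.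
by exists (s g^-1%g x) => //; rewrite actVK.
Qed.

Lemma set_act_mem g A x : set_action s g A (s g x) <-> A x.
Proof. by rewrite set_actE actK. Qed.

Lemma set_action_is_action : is_action (set_action s).
Proof.
split=> [A|g h A]; apply/seteqP; split=> x.
- by case=> y Ay <-; rewrite act1.
- by move=> Ax; exists x => //; rewrite act1.
- by case=> y Ay <-; rewrite actM; exists (s h y) => //; exists y.
- by case=> _ [y Ay <-] <-; exists y => //; rewrite actM.
Qed.

Lemma set_actC g A : ~` set_action s g A = set_action s g (~` A).
Proof. by apply/seteqP; split=> x; rewrite /setC /= set_actE /= set_actE. Qed.

Lemma set_act_sub g A B : A `<=` B -> set_action s g A `<=` set_action s g B.
Proof. exact: image_subset. Qed.

Lemma infinite_set_act g A : infinite_set A -> infinite_set (set_action s g A).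
Proof.
move=> infA fA; apply: infA; apply: (@sub_finite_set _ _ (s g^-1%g @` set_action s g A)).
  by move=> x Ax; exists (s g x); [exact/set_act_mem|exact: actK].
exact: finite_image.
Qed.

Lemma finite_orbits A : finite_set A ->
  (forall x, exists g, exists2 y, A y & x = s g y) -> finite_set (orbits s setT).
Proof.
move=> fA cov; apply: (@sub_finite_set _ _ (Defs.orbit s @` A)); last exact: finite_image.
move=> _ [x _ <-]; have [g [y Ay ->]] := cov x; exists y => //.
apply/seteqP; split=> _ [h _ <-].
  by exists (h * g^-1)%g => //; rewrite actM actK.
by exists (h * g)%g => //; rewrite actM.
Qed.

Lemma orbit_representatives : finite_set (orbits s setT) ->
  exists2 R : set S, finite_set R & forall x, exists g, exists2 r, R r & x = s g r.
Proof.
move=> fO; have /choice[r rP] : forall O, exists r : option S, orbits s setT O ->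
    exists2 x, r = Some x & O x.
  move=> O; have [[x _ <-]|n] := pselect (orbits s setT O); last by exists None.
  by exists (Some x) => _; exists x => //; exists 1%g => //; apply: act1.
exists (some @^-1` (r @` orbits s setT)).
  apply: finite_preimage; last exact: finite_image.
  by move=> x y _ _ [].
move=> x; have [|y ry [g _ gx]] := rP (Defs.orbit s x); first by exists x.
exists g^-1%g; exists y; last by rewrite -gx actK.
by exists (Defs.orbit s x) => //; exists x.
Qed.

(** The action is proper: the elements moving x to a given vertex form a coset of
   the stabilizer of x. *)
Lemma finite_movers x A : finite_set (stabilizer s x) -> finite_set A ->
  finite_set [set g | A (s g x)].
Proof.
move=> fs fA; apply: (@sub_finite_set _ _ (\bigcup_(y in A) [set g | s g x = y])).
  by move=> g Ag; exists (s g x).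
apply: bigcup_finite => // y _.
have [[g0 e]|n] := pselect (exists g, s g x = y); last first.
  by apply: (@sub_finite_set _ _ set0) => // g e; case: n; exists g.
apply: (@sub_finite_set _ _ ((fun h => (g0 * h)%g) @` stabilizer s x)).
  move=> g ge; exists (g0^-1 * g)%g; last by rewrite mulgA mulgV mul1g.
  by rewrite /stabilizer /= actM ge -e actK.
exact: finite_image.
Qed.

End Action.

Section GraphAction.
Variables (Gam : sgraph) (G : groupType) (a : G -> Gam -> Gam).
Hypothesis aP : graph_action a.
Implicit Types (g h : G) (C D E : set Gam) (alpha : int -> Gam).

Let act : is_action a. Proof. exact: aP.1. Qed.
Let adj_act g u v : adj (a g u) (a g v) = adj u v. Proof. exact: aP.2. Qed.

Local Notation "g *: C" := (set_action a g C).
Local Notation greach := (reach (@adj Gam)).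

Let sact : is_action (set_action a). Proof. exact: set_action_is_action. Qed.

Lemma reach_act g A u v : greach A u v -> greach (g *: A) (a g u) (a g v).
Proof.
move=> uv; have Au := reach_inl uv.
move: uv; apply: (@reach_ind _ _ A (fun v => greach (g *: A) (a g u) (a g v))).
  by apply: reach_refl; apply/set_act_mem.
move=> x y Ax Ay xy ux; apply: reach_trans ux _.
by apply: reach_step; rewrite ?adj_act //; apply/set_act_mem.
Qed.

Lemma connected_act g A : connected_in A -> connected_in (g *: A).
Proof.
move=> /connected_inP cA; apply/connected_inP => _ _ [u Au <-] [v Av <-].
exact/reach_act/cA.
Qed.

Lemma boundary_act_sub g C e : boundary C e -> boundary (g *: C) (g *: e).
Proof.
move=> /boundaryP[u [v [uv Cu nCv ->]]].
have -> : g *: [set u; v] = [set a g u; a g v].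
  apply/seteqP; split=> [_ [x [] -> <-]|x [] ->];
    by [left|right|exists u => //; left|exists v => //; right].
apply: boundary_mk; rewrite ?adj_act //; first exact/set_act_mem.
by move/set_act_mem => /(_ act).
Qed.

Lemma boundary_act g C : boundary (g *: C) = set_action a g @` boundary C.
Proof.
apply/seteqP; split=> [e be|_ [e be <-]]; last exact: boundary_act_sub.
exists (g^-1%g *: e); last exact: (actVK sact).
by rewrite -(actK sact g C); apply: boundary_act_sub.
Qed.

Lemma ends_act g C x : ends C x -> ends (g *: C) (a g x).
Proof.
move=> [e be ex]; exists (g *: e); first exact: boundary_act_sub.
exact/set_act_mem.
Qed.

Lemma card_boundary_act g C : (boundary (g *: C) #= boundary C)%card.
Proof.
rewrite boundary_act; apply: inj_card_eq => e f _ _; exact: (act_inj sact).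
Qed.

Lemma cut_act g C : cut C -> cut (g *: C).
Proof.
case=> -[u Cu] [v nCv] cC cnC fC; split.
- by exists (a g u); apply/set_act_mem.
- by exists (a g v); rewrite set_actC //; apply/set_act_mem.
- exact: connected_act.
- by rewrite set_actC //; exact: connected_act.
- by rewrite boundary_act; exact: finite_image.
Qed.

Lemma kcut_act k g C : kcut k C -> kcut k (g *: C).
Proof.
case=> cC le; split; first exact: cut_act.
by rewrite (card_le_eql (card_boundary_act g C)).
Qed.

Lemma nested_act g C D : nested C D -> nested (g *: C) (g *: D).
Proof.
by case=> h; [apply: Or41|apply: Or42|apply: Or43|apply: Or44];
  rewrite ?set_actC //; apply: set_act_sub.
Qed.

Lemma crossing_act_sub k g C D : crossing k C D -> crossing k (g *: C) (g *: D).
Proof.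
case=> kD nn; split; first exact: kcut_act.
by move=> /(nested_act g^-1%g); rewrite !(actK sact).
Qed.

Lemma card_crossing_act k g C : (crossing k (g *: C) #= crossing k C)%card.
Proof.
have -> : crossing k (g *: C) = set_action a g @` crossing k C.
  apply/seteqP; split=> [D cD|_ [D cD <-]]; last exact: crossing_act_sub.
  exists (g^-1%g *: D); last exact: (actVK sact).
  by rewrite -(actK sact g C); apply: crossing_act_sub.
by apply: inj_card_eq => e f _ _; exact: (act_inj sact).
Qed.

Lemma biinfinite_act g alpha : biinfinite_path alpha -> biinfinite_path (a g \o alpha).
Proof.
move=> [inj step]; split=> [i j /(act_inj act)/inj//|i].
by rewrite /= adj_act.
Qed.

Lemma cuts_act g alpha C : cuts alpha C -> cuts (a g \o alpha) (g *: C).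
Proof.
move=> [cC infC infnC]; split; first exact: cut_act.
- apply: sub_infinite_set (@infinite_set_act _ _ _ act g _ infC) => _ [x [[i _ <-] Cx] <-].
  by split; [exists i|exact/set_act_mem].
- apply: sub_infinite_set (@infinite_set_act _ _ _ act g _ infnC) => _ [x [[i _ <-] Cx] <-].
  by split; [exists i|rewrite set_actC //; exact/set_act_mem].
Qed.

Let alphaK g alpha : a g^-1%g \o (a g \o alpha) = alpha.
Proof. by apply: funext => i /=; rewrite actK. Qed.

Lemma cuts_min_act g alpha C : cuts_min alpha C -> cuts_min (a g \o alpha) (g *: C).
Proof.
move=> [cC min]; split; first exact: cuts_act.
move=> D /(cuts_act g^-1%g); rewrite alphaK => /min.
by rewrite (card_le_eql (card_boundary_act g C)) (card_le_eqr (card_boundary_act _ D)).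
Qed.

Lemma opt_act k g C : cuts_opt Gam k C -> cuts_opt Gam k (g *: C).
Proof.
move=> [alpha ha [mC min]]; exists (a g \o alpha); first exact: biinfinite_act.
split; first exact: cuts_min_act.
move=> D /(cuts_min_act g^-1%g); rewrite alphaK => /min.
by rewrite (card_le_eql (card_crossing_act k g C)) (card_le_eqr (card_crossing_act k _ D)).
Qed.

Lemma sim_act k g C D : cut_sim k C D -> cut_sim k (g *: C) (g *: D).
Proof.
case=> [->|[/strict_subsetP[CD ne] cover]]; [by left|right].
rewrite set_actC //; split.
  apply/strict_subsetP; split; first exact: set_act_sub.
  by move=> /(act_inj sact).
move=> E /(opt_act g^-1%g) oE /strict_subsetP[CE neE] ED.
rewrite -[E](actVK sact g); congr (g *: _); apply: cover => //.
  rewrite -[X in X `<` _](actK sact g); apply/strict_subsetP; split; first exact: set_act_sub.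
  by move=> /(act_inj sact).
by rewrite -[X in _ `<=` X](actK sact g); apply: set_act_sub.
Qed.

Section TreeAction.
Variable k : nat.
Hypothesis conn : connected_graph Gam.
Hypothesis acc : accessible_with Gam k.

Local Notation T := (structure_tree Gam k).

Definition edge_act g (e : st_edge Gam k) : st_edge Gam k :=
  edge_of (opt_act g (st_opt e)).

(** The image of a class is computed on a chosen representative;
   [vertex_act_class] shows that the choice is immaterial. *)
Definition vertex_act g (x : st_vertex Gam k) : st_vertex Gam k :=
  st_class (edge_act g (projT1 (cid (st_class_ex x)))).

Lemma edge_act_is_action : is_action edge_act.
Proof.
by split=> [e|g h e]; apply: val_inj; rewrite /= ?sact.1 ?sact.2.
Qed.

Lemma vertex_act_class g e : vertex_act g (st_class e) = st_class (edge_act g e).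
Proof.
rewrite /vertex_act; case: cid => f /= /(st_class_eq conn acc) fe.
by apply/(st_class_eq conn acc); apply: sim_act.
Qed.

Lemma vertex_act_is_action : is_action vertex_act.
Proof.
split=> [x|g h x]; have [e <-] := st_class_ex x; rewrite !vertex_act_class.
  by rewrite edge_act_is_action.1.
by rewrite edge_act_is_action.2.
Qed.

Lemma edge_act_inv g e : st_inv (edge_act g e) = edge_act g (st_inv e).
Proof. by apply: val_inj; rewrite /= set_actC. Qed.

Lemma tree_action : dgraph_action (T := T) vertex_act edge_act.
Proof.
split.
- exact: vertex_act_is_action.
- exact: edge_act_is_action.
- by move=> g e; rewrite /= vertex_act_class.
- by move=> g e; rewrite /= vertex_act_class edge_act_inv.
- exact: edge_act_inv.
Qed.

Hypothesis stab : forall v : Gam, finite_set (stabilizer a v).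

(** An element fixing C permutes the ends of C. *)
Lemma finite_cut_stabilizer C : cut C -> finite_set (stabilizer (set_action a) C).
Proof.
move=> cC; have [x xC] : ends C !=set0 by case: cC => ? ? _ _ _; apply: ends_nonempty.
apply: sub_finite_set (finite_movers act (stab x) (finite_ends (finite_boundary cC))).
by move=> g gC; rewrite /= -[in ends C]gC; exact: ends_act.
Qed.

Lemma finite_edge_stabilizer e : finite_set (stabilizer edge_act e).
Proof.
apply: sub_finite_set (finite_cut_stabilizer (opt_cut acc (st_opt e))).
by move=> g /(congr1 (@st_cut Gam k)).
Qed.

Hypothesis lf : locally_finite Gam.
Hypothesis fq : finite_set (orbits a setT).

(** Move an end of the cut to an orbit representative: the translate splits the
   finite set formed by the representatives and their neighbours. *)
Lemma opt_representatives : exists R : set (set Gam),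
  [/\ finite_set R, R `<=` cuts_opt Gam k &
      forall C, cuts_opt Gam k C -> exists g, exists2 D, R D & C = g *: D].
Proof.
have [R fR covR] := orbit_representatives act fq.
have fN := finite_neighbours lf fR.
set N := [set y | _] in fN.
have fA : finite_set (R `|` N) by rewrite finite_setU.
exists [set C | cuts_opt Gam k C /\ splits (R `|` N) C]; split.
- apply: sub_finite_set (finite_kcuts_splitting k fA) => C [oC sC].
  by split=> //; exact: opt_kcut oC.
- by move=> C [].
move=> C oC; have [[u Cu] [v nCv] _ _ _] := opt_cut acc oC.
have [x [y [Cx nCy xy]]] := cross_edge conn Cu nCv.
have [g [r Rr xr]] := covR x.
have yr : a g (a g^-1%g y) = y by rewrite actVK.
exists g; exists (g^-1%g *: C); last by rewrite (actVK sact).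
split; first exact: opt_act.
exists r, (a g^-1%g y); split.
- by left.
- by right; exists r => //; rewrite -(adj_act g) -xr yr.
- by apply/set_actE => //; rewrite invgK -xr.
- by move=> /set_actE; rewrite invgK yr => /(_ act).
Qed.

Lemma tree_finite_quotient : finite_dquotient (T := T) vertex_act edge_act.
Proof.
have [R [fR Ropt cov]] := opt_representatives.
have fE : finite_set [set e : st_edge Gam k | R (st_cut e)].
  by apply: finite_preimage => // e f _ _; exact: val_inj.
have covE e : exists g, exists2 f, R (st_cut f) & e = edge_act g f.
  have [g [D RD eD]] := cov _ (st_opt e).
  by exists g; exists (edge_of (Ropt _ RD)) => //; apply: val_inj.
split; last exact: (finite_orbits edge_act_is_action fE).
apply: (finite_orbits vertex_act_is_action (finite_image (@st_class Gam k) fE)) => x.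
have [e <-] := st_class_ex x; have [g [f Rf ->]] := covE e.
by exists g; exists (st_class f); [exists f|rewrite vertex_act_class].
Qed.

End TreeAction.
End GraphAction.

(** * Rays and bi-infinite paths *)

Section Rays.
Variable Gam : sgraph.
Hypothesis conn : connected_graph Gam.
Implicit Types (A B P C : set Gam) (u v w x y : Gam) (r s : nat -> Gam).

Local Notation greach := (reach (@adj Gam)).

Definition ray A r :=
  [/\ injective r, forall n, adj (r n) (r n.+1) & forall n, A (r n)].

Lemma infinite_range_inj (S : Type) (f : nat -> S) : injective f -> infinite_set (range f).
Proof.
move=> inj fin; apply: infinite_nat.
apply: (@sub_finite_set _ _ (f @^-1` range f)); first by move=> n _; exists n.
by apply: finite_preimage => // i j _ _ /inj.
Qed.

Section Koenig.
Hypothesis lf : locally_finite Gam.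

(** Koenig's step: every other vertex reached from v is reached from a neighbour
   of v without returning to v, and v has finitely many neighbours. *)
Lemma ray_step A v : infinite_set (greach A v) ->
  exists u, adj v u /\ infinite_set (greach (A `\ v) u).
Proof.
move=> inf; apply: contrapT => h; apply: inf.
apply: (@sub_finite_set _ _
  ([set v] `|` \bigcup_(u in [set u | adj v u]) greach (A `\ v) u)).
  move=> x /reach_shorten[[|u p] [/= pp pl pu pA]]; first by left.
  move: pp pu => /andP[vu pp] /andP[vp _].
  right; exists u => //; exists p; split=> // w wp; split.
    by apply: pA; rewrite inE wp orbT.
  by move=> wv; move: vp; rewrite -wv wp.
rewrite finite_setU; split; first exact: finite_set1.
apply: bigcup_finite => [|u vu]; first exact: lf.
by apply: contrapT => inf; apply: h; exists u.
Qed.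

Lemma ray_exists A v : infinite_set (greach A v) -> exists r, ray A r.
Proof.
move=> inf.
have /choice[nxt nxtP] : forall t : set Gam * Gam, exists u,
    infinite_set (greach t.1 t.2) ->
    adj t.2 u /\ infinite_set (greach (t.1 `\ t.2) u).
  move=> [B w] /=; have [/ray_step[u h]|n] := pselect (infinite_set (greach B w)).
    by exists u.
  by exists w.
pose st n := iter n (fun t => (t.1 `\ t.2, nxt t)) (A, v).
have stP n : infinite_set (greach (st n).1 (st n).2).
  by elim: n => //= n IH; case: (nxtP _ IH).
have stA n : (st n).1 (st n).2.
  by have [x /reach_inl] := infinite_setN0 (stP n).
have dec n m : (st (n + m)).1 `<=` (st n).1.
  elim: m => [|m IH]; first by rewrite addn0.
  by rewrite addnS => x [/IH].
exists (fun n => (st n).2); split.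
- suff ne n m : n < m -> (st n).2 <> (st m).2.
    by move=> n m e; case: (ltngtP n m) => // /ne; rewrite e.
  move=> nm e; have := stA m; rewrite -(subnKC nm) => /dec[_]; apply.
  by rewrite subnKC.
- by move=> n; case: (nxtP _ (stP n)).
- by move=> n; have := dec 0 n; rewrite add0n; apply.
Qed.

(** The part of P in C falls apart into finitely many components, each touching
   the boundary of C; an infinite one carries a ray. *)
Lemma ray_in_cut P C : connected_in P -> finite_set (boundary C) ->
  infinite_set (P `&` C) -> P `&` ~` C !=set0 -> exists r, ray (P `&` C) r.
Proof.
move=> /connected_inP cP fC inf [b [Pb nCb]].
suff [z zinf] : exists z, infinite_set (greach (P `&` C) z) by exact: ray_exists zinf.
apply: contrapT => h; apply: inf.
apply: (@sub_finite_set _ _ (\bigcup_(z in ends C) greach (P `&` C) z)).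
  move=> x [Px Cx]; have [z [t [xz _ nCt zt]]] := reach_exit (cP x b Px Pb) Cx nCb.
  have [_ Cz] := reach_inr xz.
  by exists z; [case: (ends_mk zt Cz nCt)|exact: reachC].
apply: bigcup_finite => [|z _]; first exact: finite_ends.
by apply: contrapT => zinf; apply: h; exists z.
Qed.

End Koenig.

(** Two disjoint rays are spliced along a shortest path between them: by
   minimality it meets each ray only at its endpoint. *)
Lemma join_rays A B r s : ray A r -> ray B s -> (forall x, A x -> ~ B x) ->
  exists alpha (Q : set Gam), [/\ biinfinite_path alpha, finite_set Q,
    range alpha `<=` A `|` B `|` Q,
    infinite_set (range alpha `&` A) & infinite_set (range alpha `&` B)].
Proof.
move=> [rinj radj rA] [sinj sadj sB] dis.
have [|[i j] _ min] := @ex_argmin _ (fun _ : nat * nat => True)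
  (fun ij => dist conn (r ij.1) (s ij.2)); first by exists (0, 0).
have [q [pq lq uq sq]] := dist_path conn (r i) (s j).
set L := size q; pose pt n := nth (r i) (r i :: q) n.
(* Otherwise a proper final segment of the path would join the rays. *)
have ptr n i' : n <= L -> pt n = r i' -> n = 0.
  move=> nL e; have := min (i', j) I; rewrite /= -sq -/L.
  suff : dist conn (r i') (s j) <= L - n by lia.
  rewrite -e -(size_drop n q); apply: dist_le.
    case: n nL {e} => [|n] nL; first by rewrite drop0.
    move: pq; rewrite -{1}(cat_take_drop n.+1 q) cat_path (last_nth (r i)).
    by rewrite size_takel // /pt /= nth_take // => /andP[].
  case: n nL {e} => [|n] nL; first by rewrite drop0.
  rewrite -lq -{2}(cat_take_drop n.+1 q) last_cat; congr last.
  by rewrite (last_nth (r i)) size_takel //= nth_take.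
(* Otherwise a proper initial segment of the path would join the rays. *)
have pts n j' : n <= L -> pt n = s j' -> n = L.
  move=> nL e; have := min (i, j') I; rewrite /= -sq -/L.
  suff : dist conn (r i) (s j') <= n by lia.
  rewrite -e -{2}(size_takel nL); apply: dist_le.
    by move: pq; rewrite -{1}(cat_take_drop n q) cat_path => /andP[].
  by rewrite (last_nth (r i)) size_takel // /pt; case: n nL {e} => //= n nL; rewrite nth_take.
have ptL : pt L = s j by rewrite -lq (last_nth (r i)).
pose b n := if n <= L then pt n else s (j + (n - L)).
have bL n : L <= n -> b n = s (j + (n - L)).
  rewrite /b leq_eqVlt => /orP[/eqP<-|Ln]; first by rewrite leqnn subnn addn0.
  by rewrite leqNgt Ln.
have badj n : adj (b n) (b n.+1).
  have [nL|nL] := ltnP n L.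
    by rewrite /b nL (ltnW nL); move/(pathP (r i)): pq; apply.
  by rewrite !bL ?(leqW nL) // subSn // addnS.
have binj n m : n < m -> b n <> b m.
  move=> nm; have [mL|mL] := leqP m L.
    rewrite /b mL (leq_trans (ltnW nm) mL) => /eqP.
    by rewrite nth_uniq //=; lia.
  rewrite (bL m) ?(ltnW mL) //; have [nL|nL] := leqP n L.
    rewrite /b nL => e; have nL' := pts _ _ nL e.
    by move: e; rewrite nL' ptL => /sinj; lia.
  by rewrite bL ?(ltnW nL) // => /sinj; lia.
have br n m : b n <> r (i + m.+1).
  have [nL|nL] := leqP n L.
    rewrite /b nL => e; have n0 := ptr _ _ nL e.
    by move: e; rewrite n0 /pt /= => /rinj; lia.
  by rewrite bL ?(ltnW nL) // => e; apply: (dis (r (i + m.+1))) => //; rewrite -e.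
(* The vertex r i is already taken by b 0, so the ray r resumes at i + 1. *)
pose alpha (z : int) := match z with Posz n => b n | Negz n => r (i + n.+1) end.
exists alpha, (pt @` `I_L.+1); split.
- split=> [[n|n] [m|m] //= e|[[|n]|n]].
  + by congr Posz; case: (ltngtP n m) => // /binj; rewrite e.
  + by case: (br n m).
  + by case: (br m n).
  + by congr Negz; move/rinj: e; lia.
  + by rewrite /= /b /pt /= addn1 adj_sym.
  + by rewrite -[(Posz n.+1 - 1)%R]/(Posz n.+1 + Negz 0)%R /= subn1; exact: badj.
  + rewrite -[(Negz n - 1)%R]/(Negz (n + 0).+1) addn0 /= adj_sym.
    by rewrite !addnS; exact: radj.
- by apply: finite_image; exact: finite_II.
- move=> _ [[n|n] _ <-] /=; last by left; left.
  have [nL|nL] := leqP n L; last by left; right; rewrite bL ?(ltnW nL).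
  by right; exists n; rewrite /= ?ltnS // /b nL.
- apply: (@sub_infinite_set _ (range (fun n => r (i + n.+1)))).
    by move=> _ [n _ <-]; split=> //; exists (Negz n).
  by apply: infinite_range_inj => n m /rinj; lia.
- apply: (@sub_infinite_set _ (range (fun n => s (j + n)))).
    move=> _ [n _ <-]; split=> //; exists (Posz (L + n)) => //=.
    by rewrite bL ?leq_addr // addKn.
  by apply: infinite_range_inj => n m /sinj; lia.
Qed.

End Rays.

(** * Finiteness of vertex stabilizers *)

Section VertexStabilizer.
Variables (Gam : sgraph) (G : groupType) (a : G -> Gam -> Gam).
Hypothesis aP : graph_action a.
Hypothesis conn : connected_graph Gam.
Hypothesis lf : locally_finite Gam.
Variable k : nat.
Hypothesis acc : accessible_with Gam k.
Hypothesis stab : forall v : Gam, finite_set (stabilizer a v).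
Hypothesis fq : finite_set (orbits a setT).
Variable K : nat.
Hypothesis bal : forall (P : set Gam) n, infinite_set P ->
  exists C, [/\ kcut K C, many n (P `&` C) & many n (P `&` ~` C)].
Implicit Types (g h : G) (C D E : set Gam) (u v w x y z : Gam).

Local Notation opt := (cuts_opt Gam k).
Local Notation "g *: C" := (set_action a g C).
Local Notation greach := (reach (@adj Gam)).

Let act : is_action a. Proof. exact: aP.1. Qed.
Let sact : is_action (set_action a). Proof. exact: set_action_is_action. Qed.

Variable C : set Gam.
Hypothesis oC : opt C.

(* S is the class of C; an element stabilizes it as soon as it maps C into it. *)
Let S := cut_class k C.
Let H : set G := [set g | S (g *: C)].

Let S_opt D : S D -> opt D. Proof. by case. Qed.
Let S_C : S C. Proof. by split=> //; exact: sim_refl. Qed.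

Let S_act g D : H g -> S D -> S (g *: D).
Proof.
move=> [ogC CgC] [oD CD]; split; first exact: opt_act.
apply: (sim_trans conn acc oC ogC) => //; first exact: opt_act.
exact: sim_act.
Qed.

Let S_H g D : S D -> S (g *: D) -> H g.
Proof.
move=> [oD CD] [ogD CgD]; split; first exact: opt_act.
apply: (sim_trans conn acc oC ogD) => //; first exact: opt_act.
by apply: sim_sym => //; [exact: opt_act|exact: sim_act].
Qed.

Let H_inv g : H g -> H g^-1%g.
Proof. by move=> Hg; apply: (S_H Hg); rewrite (actK sact). Qed.

(* Each of two distinct cuts of the class contains the complement of the other. *)
Let S_disjoint D E x : S D -> S E -> ~ D x -> ~ E x -> D = E.
Proof.
move=> [oD CD] [oE CE] nDx nEx.
have : cut_sim k D E by apply: (sim_trans conn acc oD oC oE) => //; exact: sim_sym.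
by case=> [//|[[sub _] _]]; case: nEx; apply: sub.
Qed.

(** In the tree the edge E lies beyond one of the edges at the vertex [C]: if C
   itself does not hide a side of E, a cut covering the complement of C on the
   way to E does. *)
Let S_hides E : opt E -> exists2 D, S D & E `<=` ~` D \/ ~` E `<=` ~` D.
Proof.
move=> oE; have cover B : opt B -> ~` C `<=` B ->
    exists2 D, S D & B `<=` ~` D \/ ~` B `<=` ~` D.
  move=> oB CB; have [e|/eqP ne] := eqVneq (~` C) B.
    by exists C => //; left; rewrite e.
  have [D [oD CD DB]] := cover_exists acc oC oB ((strict_subsetP _ _).2 (conj CB ne)).
  by exists D => //; right; exact: subsetC.
case: (opt_nested conn acc oE oC) => h.
- have [|D SD] := cover (~` E) (cuts_optC oE); first exact: subsetC.
  by rewrite setCK => -[]; exists D; auto.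
- by exists C => //; left.
- exact: cover oE (setC_sub h).
- by exists C => //; right.
Qed.

(** Each G-orbit of optimal cuts meets the class in at most one H-orbit, as two cuts
   of the class in one G-orbit differ by an element of H. *)
Let S_representatives : exists R : set (set Gam),
  [/\ finite_set R, R `<=` S &
      forall D, S D -> exists h, exists2 D0, R D0 & H h /\ D = h *: D0].
Proof.
have [R [fR _ cov]] := opt_representatives aP conn acc lf fq.
have /choice[f fP] : forall r, exists D, (exists g, S (g *: r)) ->
    S D /\ exists g, D = g *: r.
  move=> r; have [[g Sg]|n] := pselect (exists g, S (g *: r)); last by exists r.
  by exists (g *: r) => _; split=> //; exists g.
exists ((f @` R) `&` S); split.
- by apply: finite_setIl; exact: finite_image.
- by move=> D [].
move=> D SD; have [g [r Rr Dr]] := cov D (S_opt SD).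
have [|Sf [g' fr]] := fP r; first by exists g; rewrite -Dr.
have eD : D = (g * g'^-1)%g *: f r by rewrite (actM sact) fr (actK sact).
exists (g * g'^-1)%g; exists (f r); first by split=> //; exists r.
by split=> //; apply: (S_H Sf); rewrite -eD.
Qed.

(** Tiles measure nearness in the graph in a G-invariant way.  The tile is a
   connected hull of representatives of the vertices and of the ends of
   representatives of the optimal cuts. *)
Let tile_exists : exists Z : set Gam, [/\ finite_set Z, connected_in Z,
  forall v, exists g, (g *: Z) v,
  forall E, opt E -> exists g, ends E `<=` g *: Z &
  forall g, exists2 E, opt E & ends E `<=` g *: Z].
Proof.
have [Rv fRv covv] := orbit_representatives act fq.
have [R [fR Ropt cov]] := opt_representatives aP conn acc lf fq.
have fE : finite_set (Rv `|` \bigcup_(r in R) ends r).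
  rewrite finite_setU; split=> //; apply: bigcup_finite => // r Rr.
  by apply/finite_ends/finite_boundary/(opt_cut acc)/Ropt.
have [Z [fZ sub cZ]] := finite_connected_hull conn fE.
have subE g r : R r -> ends (g *: r) `<=` g *: Z.
  move=> Rr x xE; apply/set_actE => //; apply: sub; right; exists r => //.
  by rewrite -(actK sact g r); exact: ends_act.
exists Z; split=> //.
- by move=> v; have [g [r Rr ->]] := covv v; exists g, r => //; apply: sub; left.
- by move=> E oE; have [g [r Rr ->]] := cov E oE; exists g; exact: subE.
- move=> g; have [_ [r Rr _]] := cov C oC.
  by exists (g *: r); [exact/opt_act/Ropt|exact: subE].
Qed.

Let Z : set Gam := projT1 (cid tile_exists).
Let ZP := projT2 (cid tile_exists).
Let finZ : finite_set Z. Proof. by case: ZP. Qed.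
Let tile_cover v : exists g, (g *: Z) v. Proof. by case: ZP => _ _ h _ _; apply: h. Qed.
Let tile_ends E : opt E -> exists g, ends E `<=` g *: Z.
Proof. by case: ZP => _ _ _ h _; apply: h. Qed.
Let tile_cut g : exists2 E, opt E & ends E `<=` g *: Z.
Proof. by case: ZP => _ _ _ _; apply. Qed.
Let tile_connected g : connected_in (g *: Z).
Proof. by apply: connected_act => //; case: ZP. Qed.

Let border : set Gam := [set x | exists2 D, S D & ends D x].

(** A coarse model of the vertex [C]: the vertices near the boundary of some cut of
   the class.  It plays the part of a graph on which H acts with finite quotient. *)
Let block : set Gam :=
  [set v | exists g, (g *: Z) v /\ exists2 x, (g *: Z) x & border x].

Let block_tile g x : (g *: Z) x -> border x -> g *: Z `<=` block.
Proof. by move=> gx bx v gv; exists g; split=> //; exists x. Qed.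

Let block_border : border `<=` block.
Proof.
move=> x bx; have [g gx] := tile_cover x.
exact: (block_tile gx bx gx).
Qed.

Let tile_link g x u v : (g *: Z) x -> border x -> (g *: Z) u -> (g *: Z) v ->
  greach block u v.
Proof.
move=> gx bx gu gv; apply: (reach_sub (block_tile gx bx)).
exact: (connected_inP _).1 (@tile_connected g) u v gu gv.
Qed.

Let ends_link D x y : S D -> ends D x -> ends D y -> greach block x y.
Proof.
move=> SD xD yD; have [g sub] := tile_ends (S_opt SD).
by apply: (@tile_link g x); [exact: sub|exists D|exact: sub|exact: sub].
Qed.

(** The tile of v contains the ends of an optimal cut, one of which is behind a
   cut D of the class; on the way there, inside the tile, the boundary of D is met. *)
Let block_core v : (forall D, S D -> D v) -> block v.
Proof.
move=> Sv; have [g gv] := tile_cover v; have [E oE sub] := tile_cut g.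
have [[u Eu] [w nEw] _ _ _] := opt_cut acc oE.
have [x [y [Ex nEy xy]]] := cross_edge conn Eu nEw.
have [/sub gx /sub gy] := ends_mk xy Ex nEy.
have [D SD hid] := S_hides oE.
have [z gz nDz] : exists2 z, (g *: Z) z & ~ D z.
  by case: hid => hid; [exists x => //; exact: hid|exists y => //; exact: hid].
have vz := (connected_inP _).1 (@tile_connected g) v z gv gz.
have [x' [y' [/reach_inr[gx' Dx'] _ nDy' xy']]] := reach_exit vz (Sv D SD) nDz.
by exists g; split=> //; exists x' => //; exists D => //; case: (ends_mk xy' Dx' nDy').
Qed.

(** A path of the graph is replaced by a connection in the block.  While the path
   runs behind a cut of the class, the connection keeps all the ends of that cut
   within reach; wherever the path reappears, it does so at one of them. *)
Let block_connected : connected_in block.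
Proof.
have [[u Cu] [w nCw] _ _ _] := opt_cut acc oC.
have [c [x0 [Cc nCx0 cx0]]] := cross_edge conn Cu nCw.
have [_ x0C] := ends_mk cx0 Cc nCx0.
pose linked v := ((forall D, S D -> D v) -> greach block x0 v) /\
  (forall D, S D -> ~ D v -> forall y, ends D y -> greach block x0 y).
have all_linked v : linked v.
  apply: (@reach_ind _ _ setT linked x0 v); last exact: reachT.
    split=> [/(_ C S_C)//|D SD nDx0 y yD].
    by rewrite -(S_disjoint S_C SD nCx0 nDx0) in yD; exact: ends_link x0C yD.
  move=> x y _ _ xy [core hidden].
  have [[D [SD nDx nDy]]|apart] := pselect (exists D, [/\ S D, ~ D x & ~ D y]).
    split=> [/(_ D SD)//|E SE nEy z zE].
    rewrite -(S_disjoint SD SE nDy nEy) in zE; exact: hidden nDx z zE.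
  have x0y : greach block x0 y.
    have [[D [SD nDx]]|vis] := pselect (exists D, S D /\ ~ D x).
      have Dy : D y by apply: contrapT => nDy; apply: apart; exists D.
      by apply: (hidden D SD nDx); case: (ends_mk2 xy nDx Dy).
    have Sx D : S D -> D x by move=> SD; apply: contrapT => nDx; apply: vis; exists D.
    apply: reach_trans (core Sx) _; apply: reach_step => //.
      exact: reach_inr (core Sx).
    have [[D [SD nDy]]|vis'] := pselect (exists D, S D /\ ~ D y).
      by apply: block_border; exists D => //; case: (ends_mk xy (Sx D SD) nDy).
    by apply: block_core => D SD; apply: contrapT => nDy; apply: vis'; exists D.
  split=> // D SD nDy z zD; apply: reach_trans x0y _.
  have Dx : D x by apply: contrapT => nDx; apply: apart; exists D.
  by apply: (ends_link SD) => //; case: (ends_mk xy Dx nDy).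
apply: (@connected_from _ _ x0) => v [g [gv [x gx bx]]].
apply: reach_trans (tile_link gx bx gx gv); case: (bx) => D SD xD.
have [_ [w' nDw'] _ _ _] := opt_cut acc (S_opt SD).
have [[u' Du'] _ _ _ _] := opt_cut acc (S_opt SD).
have [y [z [Dy nDz yz]]] := cross_edge conn Du' nDw'.
by case: (all_linked z) => _ /(_ D SD nDz x xD).
Qed.

Let block_act h v : H h -> block v -> block (a h v).
Proof.
move=> Hh [g [gv [x gx [D SD xD]]]]; exists (h * g)%g.
rewrite (actM sact); split; first exact/set_act_mem.
exists (a h x); first exact/set_act_mem.
by exists (h *: D); [exact: S_act|exact: ends_act].
Qed.

(** A tile touching the boundary of h D_0 is the translate by h of a tile touching
   the boundary of D_0, and by properness only finitely many tiles do so. *)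
Let block_cofinite : exists2 F : set Gam, finite_set F &
  forall v, block v -> exists h, exists2 f, F f & H h /\ v = a h f.
Proof.
have [R [fR RS cov]] := S_representatives.
have fB : finite_set (\bigcup_(D in R) ends D).
  by apply: bigcup_finite => // D /RS /S_opt /(opt_cut acc) /finite_boundary /finite_ends.
set B := \bigcup_(D in R) ends D in fB.
pose M : set G := \bigcup_(z in Z) [set g | B (a g z)].
have fM : finite_set M by apply: bigcup_finite => // z _; exact: finite_movers.
exists (\bigcup_(g in M) (g *: Z)).
  by apply: bigcup_finite => // g _; exact: finite_image.
move=> v [g [gv [x gx [D SD xD]]]].
have [h [D0 RD0 [Hh eD]]] := cov D SD.
exists h; exists (a h^-1%g v); last by rewrite actVK.
have mem y : (g *: Z) y -> ((h^-1 * g)%g *: Z) (a h^-1%g y).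
  by move=> gy; rewrite (actM sact); exact/set_act_mem.
exists (h^-1 * g)%g; last exact: mem.
have [z Zz zx] := mem x gx; exists z => //=.
rewrite zx; exists D0 => //; rewrite -(actK sact h D0) -eD; exact: ends_act.
Qed.

(** Elements of H moving a fixed vertex behind D differ by elements stabilizing D,
   as the complements of the cuts of the class are disjoint. *)
Let block_hidden_finite D : S D -> finite_set (block `&` ~` D).
Proof.
move=> SD; have [F fF cov] := block_cofinite.
apply: (@sub_finite_set _ _ (\bigcup_(f in F)
   ((fun h => a h f) @` [set h | H h /\ ~ D (a h f)]))).
  move=> v [/cov[h [f Ff [Hh ->]]] nDv]; exists f => //; exists h => //.
apply: bigcup_finite => // f _; apply: finite_image.
have [[h0 [Hh0 nD0]]|n] := pselect (exists h, H h /\ ~ D (a h f)); last first.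
  by apply: (@sub_finite_set _ _ set0) => // h hh; case: n; exists h.
apply: (@sub_finite_set _ _ ((fun g => (g * h0)%g) @` stabilizer (set_action a) D)).
  move=> h [Hh nDh]; exists (h * h0^-1)%g; last by rewrite -mulgA mulVg mulg1.
  rewrite /stabilizer /= (actM sact).
  have hid g : H g -> ~ D (a g f) -> S (g^-1%g *: D) /\ ~ (g^-1%g *: D) f.
    move=> Hg nDg; split; first by apply: S_act => //; exact: H_inv.
    by move=> /set_actE; rewrite invgK => /(_ act).
  have [S0 n0] := hid h0 Hh0 nD0; have [S1 n1] := hid h Hh nDh.
  by rewrite (S_disjoint S0 S1 n0 n1) (actVK sact).
by apply: finite_image; apply: finite_cut_stabilizer => //; exact: (opt_cut acc (S_opt SD)).
Qed.

Lemma many_act (A B : set Gam) g n : (forall x, A x -> B (a g x)) ->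
  many n A -> many n B.
Proof.
move=> AB [s [us le sA]]; exists (map (a g) s); split.
- by rewrite map_inj_uniq //; exact: act_inj.
- by rewrite size_map.
- by move=> _ /mapP[x /sA /AB ? ->].
Qed.

(** A cut of bounded size that separates block vertices has, the block being
   connected, a boundary edge in the block; H moves it to a fixed finite set.  So
   finitely many cuts provide pieces of every size, and one of them provides
   infinite pieces. *)
Let block_cut : infinite_set block -> exists E,
  [/\ cut E, infinite_set (block `&` E) & infinite_set (block `&` ~` E)].
Proof.
move=> inf; have [F fF cov] := block_cofinite.
have fN := finite_neighbours lf fF; set N := [set y | _] in fN.
have fA : finite_set (F `|` N) by rewrite finite_setU.
set M := [set E | kcut K E /\ splits (F `|` N) E].
have fM : finite_set M by exact: finite_kcuts_splitting.
have big n : exists2 E, M E & many n (block `&` E) /\ many n (block `&` ~` E).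
  have [E [kE mE mnE]] := bal n.+1 inf.
  have [u [bu Eu]] : exists u, (block `&` E) u.
    by case: mE => -[|u s] [] // _ _ h; exists u; apply: h; rewrite mem_head.
  have [w [bw nEw]] : exists w, (block `&` ~` E) w.
    by case: mnE => -[|w s] [] // _ _ h; exists w; apply: h; rewrite mem_head.
  have uw := (connected_inP _).1 block_connected u w bu bw.
  have [x [y [/reach_inr[bx Ex] by' nEy xy]]] := reach_exit uw Eu nEw.
  have [h [f Ff [Hh xf]]] := cov x bx.
  have hi := H_inv Hh.
  exists (h^-1%g *: E).
    split; first exact: kcut_act.
    exists f, (a h^-1%g y); split.
    - by left.
    - by right; exists f => //; rewrite -(actK act h f) -xf aP.2.
    - by apply/set_actE => //; rewrite invgK -xf.
    - by move=> /set_actE; rewrite invgK actVK // => /(_ act).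
  split; [apply: many_le (many_act (g := h^-1%g) _ mE)
         |apply: many_le (many_act (g := h^-1%g) _ mnE)] => //.
    by move=> z [bz Ez]; split; [exact: block_act|exact/set_act_mem].
  move=> z [bz nEz]; split; first exact: block_act.
  by rewrite set_actC //; exact/set_act_mem.
apply: contrapT => none.
have /choice[f fP] : forall E, exists n, M E ->
    ~ (many n (block `&` E) /\ many n (block `&` ~` E)).
  move=> E; have [ME|nME] := pselect (M E); last by exists 0.
  have [fin|infE] := pselect (finite_set (block `&` E)).
    by have [n hn] := many_finite fin; exists n => _ [].
  have [fin|infnE] := pselect (finite_set (block `&` ~` E)).
    by have [n hn] := many_finite fin; exists n => _ [].
  by case: none; exists E; split=> //; case: ME => -[].
have [E ME [m1 m2]] := big (\max_(E <- fset_set M) f E).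
have le : f E <= \max_(E <- fset_set M) f E.
  by apply: leq_bigmax_seq => //; rewrite in_fset_set ?inE.
by apply: (fP E ME); split; exact: many_le le _.
Qed.

(** If H is infinite then so is the block, and a cut with infinitely many block
   vertices on either side splits a bi-infinite path that runs in the block up to
   finitely many vertices.  An optimal cut for this path has a side hidden behind
   a cut of the class, where the path has only finitely many vertices. *)
Lemma finite_class_stabilizer : finite_set H.
Proof.
have [x0 bx0] : block !=set0.
  have [C0 nC0 _ _ _] := opt_cut acc oC; have [x xC] := ends_nonempty conn C0 nC0.
  by exists x; apply: block_border; exists C.
have [fin|inf] := pselect (finite_set block).
  apply: sub_finite_set (finite_movers act (stab x0) fin) => h Hh.
  exact: block_act.
have [E [cE infE infnE]] := block_cut inf; exfalso.
have fE := finite_boundary cE.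
have [r rayr] := ray_in_cut lf block_connected fE infE (infinite_setN0 infnE).
have [s rays] : exists s, ray (block `&` ~` E) s.
  apply: ray_in_cut => //; first by rewrite boundaryC.
  by rewrite setCK; exact: infinite_setN0.
have [|alpha [Q [ba fQ sub infa infb]]] := join_rays conn rayr rays.
  by move=> x [_ Ex] [_ nEx].
have cuts0 : cuts alpha !=set0.
  exists E; split=> //; first by apply: sub_infinite_set infa => x [? []].
  by apply: sub_infinite_set infb => x [? []].
have [D oD] := opt_exists conn k cuts0.
have [[[_ infD infnD] _] _] := oD.
have [|B SB hid] := @S_hides D; first by exists alpha.
have fB : finite_set (range alpha `&` ~` B).
  apply: (@sub_finite_set _ _ ((block `&` ~` B) `|` Q)).
    by move=> x [/sub[[[bx _]|[bx _]]|Qx] nBx]; [left|left|right].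
  by rewrite finite_setU; split=> //; exact: block_hidden_finite.
by case: hid => hid; [apply: infD|apply: infnD]; apply: sub_finite_set fB;
  apply: setIS.
Qed.

End VertexStabilizer.

Section DegreeBound.
Variables (Gam : sgraph) (G : groupType) (a : G -> Gam -> Gam).
Hypothesis aP : graph_action a.
Hypothesis lf : locally_finite Gam.
Hypothesis fq : finite_set (orbits a setT).

Lemma degree_bound : exists d, forall v : Gam, ncard [set u | adj v u] <= d.
Proof.
have act := aP.1; have [R fR cov] := orbit_representatives act fq.
pose deg v := ncard [set u | @adj Gam v u].
exists (\max_(r <- fset_set R) deg r) => v; have [g [r Rr ->]] := cov v.
have le : deg r <= \max_(r <- fset_set R) deg r.
  by apply: leq_bigmax_seq => //; rewrite in_fset_set ?inE.
apply: leq_trans le.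
apply: ncard_le => //; apply: card_le_trans (subset_card_le _) (card_image_le (a g) _).
move=> u ru; exists (a g^-1%g u); last exact: actVK.
by rewrite /= -(aP.2 g) actVK.
Qed.

End DegreeBound.

(** * The action of the group on the structure tree *)

Theorem theorem6p25 (Gam : sgraph) (G : groupType) (a : G -> Gam -> Gam)
    (Gam_nonempty : [set: Gam] !=set0)
    (Gam_connected : connected_graph Gam)
    (Gam_locally_finite : locally_finite Gam)
    (Gam_treewidth : finite_treewidth Gam)
    (a_action : graph_action a)
    (a_quotient : finite_quotient a)
    (a_stabilizers : forall v : Gam, finite_set (stabilizer a v)) :
  accessible Gam /\
  forall k : nat, accessible_with Gam k ->
    let T := structure_tree Gam k in
    dgraph_tree T /\
    exists (av : G -> dvertex T -> dvertex T) (ae : G -> dedge T -> dedge T),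
      [/\ dgraph_action av ae,
          (forall (g : G) (C : dedge T),
             st_cut (ae g C) = set_action a g (st_cut C)) /\
          (forall (g : G) (C : dedge T),
             av g (st_class C) = st_class (ae g C)),
          forall x : dvertex T, finite_set (stabilizer av x),
          forall C : dedge T, finite_set (stabilizer ae C) &
          finite_dquotient av ae].
Proof.
have [fV _] := a_quotient.
have [d deg] := degree_bound a_action Gam_locally_finite fV.
have [TT [X [td [m width]]]] := Gam_treewidth.
have acc0 := accessible_treewidth Gam_connected Gam_locally_finite deg td width.
split; first by exists (m * d)%N.
move=> k acc T; split; first exact: st_tree.
have bal (P : set Gam) n : infinite_set P -> exists C,
    [/\ kcut (m * d) C, many n (P `&` C) & many n (P `&` ~` C)].
  exact: (balanced_cut Gam_connected Gam_locally_finite deg td width).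
exists (vertex_act a_action (k := k)), (edge_act a_action (k := k)); split.
- exact: tree_action.
- by split=> // g C; exact: vertex_act_class.
- move=> x; have [e <-] := st_class_ex x.
  apply: sub_finite_set (finite_class_stabilizer a_action Gam_connected
    Gam_locally_finite acc a_stabilizers fV bal (st_opt e)) => g.
  rewrite /stabilizer /= vertex_act_class // => /(st_class_eq Gam_connected acc) sim.
  split; first exact/opt_act/st_opt.
  by apply: sim_sym sim; [exact: (opt_act a_action g (st_opt e))|exact: st_opt].
- by move=> C; exact: finite_edge_stabilizer.
- exact: tree_finite_quotient.
Qed.
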